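(* For all $n\ge0$ the total derivatives (accounting both for the explicit dependence on the deformation variable and for the specialised spectral argument) are $$s\frac{d}{ds}\mathbf P_n(s) = \big[ \mathcal{A}^{(0,+)}_{n} + \mathcal{A}^{(\mathrm{diag})}_{n} \big]\mathbf P_n(s) - \psi t^{b+1}e^{-t} K_{n}^{0,0}(s,t)\,\mathbf P^{(1)}_n(-t),$$ $$t\frac{d}{dt}\mathbf Q_n(t) = \big[ \mathcal{D}^{(0,+)}_{n} + \mathcal{D}^{(\mathrm{diag})}_{n} \big]\mathbf Q_n(t) - \xi s^{a+1}e^{-s} K_{n}^{0,0}(s,t)\,\mathbf Q^{(1)}_n(-s),$$ $$t\frac{d}{dt}\mathbf P^{(1)}_n(-t) = \big[ \mathcal{A}^{(0,-)}_{n} + \mathcal{D}^{(\mathrm{diag})}_{n} \big]\mathbf P^{(1)}_n(-t) - \xi s^{a+1}e^{-s} K_{n}^{1,1}(-t,-s)\,\mathbf P_n(s),$$ $$s\frac{d}{ds}\mathbf Q^{(1)}_n(-s) = \big[ \mathcal{D}^{(0,-)}_{n} + \mathcal{A}^{(\mathrm{diag})}_{n} \big]\mathbf Q^{(1)}_n(-s) - \psi t^{b+1}e^{-t} K_{n}^{1,1}(-t,-s)\,\mathbf Q_n(t).$$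
   Context: Fix $a,b,\xi,\psi\in\mathbb C$ with $\Re a,\Re b>-1$. For $s,t>0$ put $w_1(x)=(1-\xi\chi_{x>s})x^ae^{-x}$, $w_2(y)=(1-\psi\chi_{y>t})y^be^{-y}$ on $(0,\infty)$, $\langle f,g\rangle=\int_0^\infty\int_0^\infty\frac{w_1(x)w_2(y)}{x+y}f(x)g(y)\,dx\,dy$, $M_{j,k}=\langle x^j,y^k\rangle$, $Z_0=1$, $Z_n=\det(M_{j,k})_{0\le j,k\le n-1}$. $P_n,Q_n$ are polynomials of degree $n$ with the same leading coefficient $S_n$ ($S_n^2=Z_n/Z_{n+1}$, branch chosen differentiably in $(s,t)$) and $\langle P_m,Q_n\rangle=\delta_{m,n}$. $\pi_n=\int_0^\infty w_1P_n\,dx$, $\eta_n=\int_0^\infty w_2Q_n\,dy$, $X_{n,n}=\langle xP_n,Q_n\rangle$, $Y_{n,n}=\langle P_n,yQ_n\rangle$. Objects with index $-1$ are $0$. $(s,t)$ ranges over an open set on which the standing generic conditions hold: all $M_{j,k}$ finite (absolutely convergent), $Z_n\ne0$, $\pi_n,\eta_n\neq0$ for all $n\ge0$. $P^{(1)}_n(z)=\int_0^\infty\frac{w_1(x)}{z-x}P_n(x)\,dx$, $Q^{(1)}_n(z)=\int_0^\infty\frac{w_2(y)}{z-y}Q_n(y)\,dy$. $\mathbf P_n(z)=(P_{n+1},P_n,P_{n-1})^T$, $\mathbf P^{(1)}_n(z)=(P^{(1)}_{n+1},P^{(1)}_n,P^{(1)}_{n-1})^T$, similarly $\mathbf Q_n$,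 $\mathbf Q_n^{(1)}$. $K^{0,0}_n(x,y)=\sum_{l=0}^nP_l(x)Q_l(y)$, $K^{1,1}_n(x,y)=\sum_{l=0}^nP^{(1)}_l(x)Q^{(1)}_l(y)+\frac1{x+y}$. Matrices: $$\mathcal{A}^{(0,+)}_{n} = \begin{pmatrix} n+1-\frac{S_{n}\pi_{n+1}}{S_{n+1}\pi_{n}} & \frac{\pi_{n+1}}{\pi_{n}}(Y_{n,n}+s) & \frac{S_{n-1}\pi_{n+1}}{S_{n}\pi_{n}}\\ -\frac{S_{n}}{S_{n+1}} & Y_{n,n}+s-n-a-b-1 & \frac{S_{n-1}}{S_{n}}\\ -\frac{S_{n}\pi_{n-1}}{S_{n+1}\pi_{n}} & -\frac{\pi_{n-1}}{\pi_{n}}(X_{n,n}-s)+\psi t^{b+1}e^{-t}P^{(1)}_{n-1}(-t)Q_{n}(t) & \frac{S_{n-1}\pi_{n-1}}{S_{n}\pi_{n}}-n-a-b\end{pmatrix},$$ $$\mathcal{A}^{(0,-)}_{n} = \begin{pmatrix} n+1+a+t-\frac{S_{n}\pi_{n+1}}{S_{n+1}\pi_{n}} & \frac{\pi_{n+1}}{\pi_{n}}(Y_{n,n}-t) & \frac{S_{n-1}\pi_{n+1}}{S_{n}\pi_{n}}\\ -\frac{S_{n}}{S_{n+1}} & Y_{n,n}-n-b-1 & \frac{S_{n-1}}{S_{n}}\\ -\frac{S_{n}\pi_{n-1}}{S_{n+1}\pi_{n}} & -\frac{\pi_{n-1}}{\pi_{n}}(X_{n,n}+t)+\xi s^{a+1}e^{-s}P_{n-1}(s)Q^{(1)}_{n}(-s)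 & \frac{S_{n-1}\pi_{n-1}}{S_{n}\pi_{n}}-n-b+t\end{pmatrix},$$ $$\mathcal{D}^{(0,+)}_{n} = \begin{pmatrix} n+1-\frac{S_{n}\eta_{n+1}}{S_{n+1}\eta_{n}} & \frac{\eta_{n+1}}{\eta_{n}}(X_{n,n}+t) & \frac{S_{n-1}\eta_{n+1}}{S_{n}\eta_{n}}\\ -\frac{S_{n}}{S_{n+1}} & X_{n,n}+t-n-a-b-1 & \frac{S_{n-1}}{S_{n}}\\ -\frac{S_{n}\eta_{n-1}}{S_{n+1}\eta_{n}} & -\frac{\eta_{n-1}}{\eta_{n}}(Y_{n,n}-t)+\xi s^{a+1}e^{-s}P_{n}(s)Q^{(1)}_{n-1}(-s) & \frac{S_{n-1}\eta_{n-1}}{S_{n}\eta_{n}}-n-a-b\end{pmatrix},$$ $$\mathcal{D}^{(0,-)}_{n} = \begin{pmatrix} n+1+b+s-\frac{S_{n}\eta_{n+1}}{S_{n+1}\eta_{n}} & \frac{\eta_{n+1}}{\eta_{n}}(X_{n,n}-s) & \frac{S_{n-1}\eta_{n+1}}{S_{n}\eta_{n}}\\ -\frac{S_{n}}{S_{n+1}} & X_{n,n}-n-a-1 & \frac{S_{n-1}}{S_{n}}\\ -\frac{S_{n}\eta_{n-1}}{S_{n+1}\eta_{n}} & -\frac{\eta_{n-1}}{\eta_{n}}(Y_{n,n}+s)+\psi t^{b+1}e^{-t}P^{(1)}_{n}(-t)Q_{n-1}(t) & \frac{S_{n-1}\eta_{n-1}}{S_{n}\eta_{n}}+s-n-a\end{pmatrix},$$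 $$\mathcal{A}^{(\mathrm{diag})}_{n} = \tfrac12\xi s^{a+1}e^{-s}\,\mathrm{diag}\big(P_{n+1}(s)Q^{(1)}_{n+1}(-s),\,-P_{n}(s)Q^{(1)}_{n}(-s),\,-P_{n-1}(s)Q^{(1)}_{n-1}(-s)\big),$$ $$\mathcal{D}^{(\mathrm{diag})}_{n} = \tfrac12\psi t^{b+1}e^{-t}\,\mathrm{diag}\big(P^{(1)}_{n+1}(-t)Q_{n+1}(t),\,-P^{(1)}_{n}(-t)Q_{n}(t),\,-P^{(1)}_{n-1}(-t)Q_{n-1}(t)\big).$$ *)

(* Defs.v *)
From HB Require Import structures.
From mathcomp Require Import all_boot all_order all_algebra.
From mathcomp Require Import complex.
From mathcomp Require Import all_classical all_reals all_analysis.

Set Implicit Arguments.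
Unset Strict Implicit.
Unset Printing Implicit Defensive.

Import Order.TTheory GRing.Theory Num.Theory.
Import numFieldNormedType.Exports.

Local Open Scope classical_set_scope.
Local Open Scope ring_scope.
Local Open Scope complex_scope.

Section ComplexCalculus.
Context {R : realType}.

(* Lebesgue integrability and integral of a complex-valued function, through
   its real and imaginary parts; integrability is absolute convergence. *)
Definition cintegrable {d : measure_display} {T : measurableType d}
    (mu : {measure set T -> \bar R}) (D : set T) (f : T -> R[i]) : Prop :=
  mu.-integrable D (fun x => (complex.Re (f x))%:E) /\
  mu.-integrable D (fun x => (complex.Im (f x))%:E).

Definition cintegral {d : measure_display} {T : measurableType d}
    (mu : {measure set T -> \bar R}) (D : set T) (f : T -> R[i]) : R[i] :=
  Rintegral mu D (fun x => complex.Re (f x)) +i*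
  Rintegral mu D (fun x => complex.Im (f x)).

Definition cdifferentiable (f : R * R -> R[i]) (p : R * R) : Prop :=
  differentiable (fun q => complex.Re (f q)) p /\
  differentiable (fun q => complex.Im (f q)) p.

Definition is_cderive (f : R -> R[i]) (x : R) (df : R[i]) : Prop :=
  is_derive x 1 (fun y => complex.Re (f y)) (complex.Re df) /\
  is_derive x 1 (fun y => complex.Im (f y)) (complex.Im df).

(* F is differentiable at x and x * F'(x) = V. *)
Definition is_euler_derive (n : nat) (F : R -> 'cV[R[i]]_n) (x : R)
    (V : 'cV[R[i]]_n) : Prop :=
  exists2 dF : 'cV[R[i]]_n,
    forall i, is_cderive (fun y => F y i 0) x (dF i 0) &
    x%:C *: dF = V.

(* x ^ z = exp (z ln x), principal branch; meaningful for x > 0. *)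
Definition cpow (x : R) (z : R[i]) : R[i] :=
  (expR (complex.Re z * ln x))%:C *
  (cos (complex.Im z * ln x) +i* sin (complex.Im z * ln x)).

End ComplexCalculus.

(* f (n - 1), with the convention that objects of index -1 vanish. *)
Definition prv {V : nmodType} (f : nat -> V) (n : nat) : V :=
  if n is m.+1 then f m else 0.

Definition vec3 {V : nmodType} (f : nat -> V) (n : nat) : 'cV[V]_3 :=
  \col_i nth 0 [:: f n.+1; f n; prv f n] i.

Definition mat3 {V : nmodType} (rows : seq (seq V)) : 'M[V]_3 :=
  \matrix_(i, j) nth 0 (nth [::] rows i) j.

Definition diag3 {V : nmodType} (x y z : V) : 'M[V]_3 :=
  diag_mx (\row_i nth 0 [:: x; y; z] i).

Section CauchyLaguerre.
Context {R : realType}.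
Local Notation C := R[i].
Local Notation mu := (@lebesgue_measure R).
Implicit Types (s t x y : R) (p q : {poly C}) (w : R -> C).

Definition halfline : set R := [set x | 0 < x].
Definition quadrant : set (R * R) := [set u | 0 < u.1 /\ 0 < u.2].

(* (1 - k 1_{x > s}) x^c e^{-x}: w1 is [weight a xi s], w2 is [weight b psi t]. *)
Definition weight (c k : C) (s x : R) : C :=
  (1 - k * (s < x)%R%:R) * cpow x c * (expR (- x))%:C.

(* k s^{c+1} e^{-s} *)
Definition jump (c k : C) (s : R) : C :=
  k * cpow s (c + 1) * (expR (- s))%:C.

Definition pairing_integrand (w1 w2 : R -> C) p q (u : R * R) : C :=
  w1 u.1 * w2 u.2 / (u.1 + u.2)%:C * p.[u.1%:C] * q.[u.2%:C].

Definition pairing (w1 w2 : R -> C) p q : C :=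
  cintegral (mu \x mu)%E quadrant (pairing_integrand w1 w2 p q).

Definition moment_integrable (w1 w2 : R -> C) (j k : nat) : Prop :=
  cintegrable (mu \x mu)%E quadrant (pairing_integrand w1 w2 'X^j 'X^k).

Definition moment_det (w1 w2 : R -> C) (n : nat) : C :=
  \det (\matrix_(j < n, k < n) pairing w1 w2 'X^j 'X^k).

Definition wint w p : C :=
  cintegral mu halfline (fun x => w x * p.[x%:C]).

Definition cauchy_transform w p (z : C) : C :=
  cintegral mu halfline (fun x => w x / (z - x%:C) * p.[x%:C]).

Section Families.
Variables (a b xi psi : C).
Variables (S : nat -> R -> R -> C) (P Q : nat -> R -> R -> {poly C}).

Definition w1 (s : R) : R -> C := weight a xi s.
Definition w2 (t : R) : R -> C := weight b psi t.
Definition Z (n : nat) (s t : R) : C := moment_det (w1 s) (w2 t) n.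

Definition pi_ (n : nat) s t : C := wint (w1 s) (P n s t).
Definition eta_ (n : nat) s t : C := wint (w2 t) (Q n s t).
Definition XX (n : nat) s t : C :=
  pairing (w1 s) (w2 t) ('X * P n s t) (Q n s t).
Definition YY (n : nat) s t : C :=
  pairing (w1 s) (w2 t) (P n s t) ('X * Q n s t).

Definition P0 (n : nat) s t (z : C) : C := (P n s t).[z].
Definition Q0 (n : nat) s t (z : C) : C := (Q n s t).[z].
Definition P1 (n : nat) s t (z : C) : C := cauchy_transform (w1 s) (P n s t) z.
Definition Q1 (n : nat) s t (z : C) : C := cauchy_transform (w2 t) (Q n s t) z.

Definition vecP (n : nat) s t (z : C) := vec3 (fun m => P0 m s t z) n.
Definition vecQ (n : nat) s t (z : C) := vec3 (fun m => Q0 m s t z) n.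
Definition vecP1 (n : nat) s t (z : C) := vec3 (fun m => P1 m s t z) n.
Definition vecQ1 (n : nat) s t (z : C) := vec3 (fun m => Q1 m s t z) n.

Definition K00 (n : nat) s t (x y : C) : C :=
  \sum_(l < n.+1) P0 l s t x * Q0 l s t y.
Definition K11 (n : nat) s t (x y : C) : C :=
  \sum_(l < n.+1) P1 l s t x * Q1 l s t y + (x + y)^-1.

Section Matrices.
Variables (n : nat) (s t : R).

Local Notation nC := (n%:R : C).
Local Notation sC := (s%:C : C).
Local Notation tC := (t%:C : C).
Local Notation Sn := (S n s t).
Local Notation Snp := (S n.+1 s t).
Local Notation Snm := (prv (fun m => S m s t) n).
Local Notation pin := (pi_ n s t).
Local Notation pinp := (pi_ n.+1 s t).
Local Notation pinm := (prv (fun m => pi_ m s t) n).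
Local Notation etan := (eta_ n s t).
Local Notation etanp := (eta_ n.+1 s t).
Local Notation etanm := (prv (fun m => eta_ m s t) n).
Local Notation Xn := (XX n s t).
Local Notation Yn := (YY n s t).
Local Notation Ps m := (P0 m s t s%:C).
Local Notation Qt m := (Q0 m s t t%:C).
Local Notation P1t m := (P1 m s t (- t%:C)).
Local Notation Q1s m := (Q1 m s t (- s%:C)).
Local Notation Psm := (prv (fun m => Ps m) n).
Local Notation Qtm := (prv (fun m => Qt m) n).
Local Notation P1tm := (prv (fun m => P1t m) n).
Local Notation Q1sm := (prv (fun m => Q1s m) n).
Local Notation cs := (jump a xi s).
Local Notation ct := (jump b psi t).

(* A0p, A0m, D0p, D0m stand for A^(0,+), A^(0,-), D^(0,+), D^(0,-). *)
Definition A0p : 'M[C]_3 := mat3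
  [:: [:: nC + 1 - (Sn * pinp) / (Snp * pin);
          pinp / pin * (Yn + sC);
          (Snm * pinp) / (Sn * pin)];
      [:: - (Sn / Snp);
          Yn + sC - nC - a - b - 1;
          Snm / Sn];
      [:: - ((Sn * pinm) / (Snp * pin));
          - (pinm / pin * (Xn - sC)) + ct * P1tm * Qt n;
          (Snm * pinm) / (Sn * pin) - nC - a - b]].

Definition A0m : 'M[C]_3 := mat3
  [:: [:: nC + 1 + a + tC - (Sn * pinp) / (Snp * pin);
          pinp / pin * (Yn - tC);
          (Snm * pinp) / (Sn * pin)];
      [:: - (Sn / Snp);
          Yn - nC - b - 1;
          Snm / Sn];
      [:: - ((Sn * pinm) / (Snp * pin));
          - (pinm / pin * (Xn + tC)) + cs * Psm * Q1s n;
          (Snm * pinm) / (Sn * pin) - nC - b + tC]].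

Definition D0p : 'M[C]_3 := mat3
  [:: [:: nC + 1 - (Sn * etanp) / (Snp * etan);
          etanp / etan * (Xn + tC);
          (Snm * etanp) / (Sn * etan)];
      [:: - (Sn / Snp);
          Xn + tC - nC - a - b - 1;
          Snm / Sn];
      [:: - ((Sn * etanm) / (Snp * etan));
          - (etanm / etan * (Yn - tC)) + cs * Ps n * Q1sm;
          (Snm * etanm) / (Sn * etan) - nC - a - b]].

Definition D0m : 'M[C]_3 := mat3
  [:: [:: nC + 1 + b + sC - (Sn * etanp) / (Snp * etan);
          etanp / etan * (Xn - sC);
          (Snm * etanp) / (Sn * etan)];
      [:: - (Sn / Snp);
          Xn - nC - a - 1;
          Snm / Sn];
      [:: - ((Sn * etanm) / (Snp * etan));
          - (etanm / etan * (Yn + sC)) + ct * P1t n * Qtm;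
          (Snm * etanm) / (Sn * etan) + sC - nC - a]].

Definition Adiag : 'M[C]_3 :=
  (2^-1 * cs) *: diag3 (Ps n.+1 * Q1s n.+1) (- (Ps n * Q1s n)) (- (Psm * Q1sm)).

Definition Ddiag : 'M[C]_3 :=
  (2^-1 * ct) *: diag3 (P1t n.+1 * Qt n.+1) (- (P1t n * Qt n)) (- (P1tm * Qtm)).

End Matrices.
End Families.
End CauchyLaguerre.

(* Main.v *)
(* Put [J_{m,n} = xi s^(a+1) e^(-s) P_m(s) Q^(1)_n(-s)] and
   [T_{m,n} = psi t^(b+1) e^(-t) P^(1)_m(-t) Q_n(t)].  Integrating by parts in both
   variables, with [x/(x+y)^2 + y/(x+y)^2 = 1/(x+y)] and boundary terms only at the
   jumps of the weights, gives
     <x p', q> + <p, y q'> = -(1+a+b) <p, q> + <x p, q> + <p, y q> - J - T,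
   while [<x p, q> + <p, y q>] factors as [(int w1 p) (int w2 q)].  Differentiating
   [<P_m, Q_n> = delta] in [s] expresses [s dP_m/ds] through [J].  In the total
   derivative [x P_m' + s dP_m/ds] the terms [J_{m,n}] with [n < m] cancel, leaving
     (m + J_{m,m}/2) P_m + sum_(l < m) (pi_m eta_l - T_{m,l}) P_l,
   and the four-term recurrence for [x P_n] rewrites [sum eta_l P_l] through
   [P_{n+1}, P_n, P_{n-1}].  The same identity for [Q_m], Cauchy transformed at [-s],
   gives the equation for [Q^(1)].  The two equations in [t] follow by exchanging the
   two weights. *)
Require Import Defs.
From HB Require Import structures.
From mathcomp Require Import all_boot all_order all_algebra.
From mathcomp Require Import complex.
From mathcomp Require Import all_classical all_reals all_analysis.
From mathcomp Require Import measurable_realfun ring lra.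

Import Order.TTheory GRing.Theory Num.Theory.
Import numFieldNormedType.Exports.

Local Open Scope classical_set_scope.
Local Open Scope ring_scope.
Local Open Scope complex_scope.
Set Implicit Arguments.
Unset Strict Implicit.
Unset Printing Implicit Defensive.

(** * Complex-valued derivatives and integrals *)

(** Only the double moments of the two weights are assumed integrable, and only the constants S_n
    are assumed differentiable. The moments of each single weight are therefore recovered from a
    slice of a double moment, and the differentiability of P_n and Q_n from that of S_n through the
    Gram-Schmidt formula. The analysis is done on monomials, where the pairing is a one-dimensional
    integral of a Stieltjes transform, so that moving a jump only moves the endpoint of a primitive.
    Linearity and degree bounds carry the results to polynomials that vary with the parameter.

    The factor 1/2 in the diagonal matrices comes from the common leading coefficient of P_n and
    Q_n, which splits J_{n,n} evenly between s dP_n/ds and s dQ_n/ds. The summand 1/(x+y) of K^{1,1}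
    is the boundary term at the jump of the transformed weight when the argument of its Cauchy
    transform moves; the shifts a + t and b + s that distinguish A^(0,-) and D^(0,-) come from the
    same derivative. All four systems are instances of one algebraic statement, [three_rowsP]. *)

Section ComplexParts.
Context {R : realType}.
Implicit Types (z u : R[i]) (r : R).

Lemma complex_ext z u :
  complex.Re z = complex.Re u -> complex.Im z = complex.Im u -> z = u.
Proof. by case: z => ? ?; case: u => ? ? /= -> ->. Qed.

Lemma Re_add z u : complex.Re (z + u) = complex.Re z + complex.Re u.
Proof. by case: z; case: u. Qed.
Lemma Im_add z u : complex.Im (z + u) = complex.Im z + complex.Im u.
Proof. by case: z; case: u. Qed.
Lemma Re_mul z u : complex.Re (z * u) =
  complex.Re z * complex.Re u - complex.Im z * complex.Im u.
Proof. by case: z; case: u. Qed.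
Lemma Im_mul z u : complex.Im (z * u) =
  complex.Re z * complex.Im u + complex.Im z * complex.Re u.
Proof. by case: z; case: u. Qed.
Lemma Re_opp z : complex.Re (- z) = - complex.Re z.
Proof. by case: z. Qed.
Lemma Im_opp z : complex.Im (- z) = - complex.Im z.
Proof. by case: z. Qed.
Lemma Re_mulr z r : complex.Re (z * r%:C) = complex.Re z * r.
Proof. by rewrite Re_mul /= mulr0 subr0. Qed.
Lemma Im_mulr z r : complex.Im (z * r%:C) = complex.Im z * r.
Proof. by rewrite Im_mul /= mulr0 add0r. Qed.
End ComplexParts.

Section ComplexDerivative.
Context {R : realType}.
Implicit Types (f g : R -> R[i]) (x : R).

Lemma is_cderive_cst (c : R[i]) x : is_cderive (fun=> c) x 0.
Proof. by split; exact: is_derive_cst. Qed.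

Lemma is_cderiveD f g x df dg : is_cderive f x df -> is_cderive g x dg ->
  is_cderive (fun y => f y + g y) x (df + dg).
Proof.
move=> [f1 f2] [g1 g2]; split.
- under [X in is_derive _ _ X _]eq_fun do rewrite Re_add.
  by rewrite Re_add; exact: is_deriveD.
- under [X in is_derive _ _ X _]eq_fun do rewrite Im_add.
  by rewrite Im_add; exact: is_deriveD.
Qed.

Lemma is_cderiveM f g x df dg : is_cderive f x df -> is_cderive g x dg ->
  is_cderive (fun y => f y * g y) x (df * g x + f x * dg).
Proof.
move=> [f1 f2] [g1 g2]; split.
- have -> : (fun y => complex.Re (f y * g y)) =
      (fun y => complex.Re (f y)) * (fun y => complex.Re (g y)) -
      (fun y => complex.Im (f y)) * (fun y => complex.Im (g y)) :> (R -> R).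
    by apply/funext => y; exact: Re_mul.
  apply: (is_derive_eq (is_deriveB (is_deriveM f1 g1) (is_deriveM f2 g2))).
  by rewrite Re_add !Re_mul /GRing.scale /=; ring.
- have -> : (fun y => complex.Im (f y * g y)) =
      (fun y => complex.Re (f y)) * (fun y => complex.Im (g y)) +
      (fun y => complex.Im (f y)) * (fun y => complex.Re (g y)) :> (R -> R).
    by apply/funext => y; exact: Im_mul.
  apply: (is_derive_eq (is_deriveD (is_deriveM f1 g2) (is_deriveM f2 g1))).
  by rewrite Im_add !Im_mul /GRing.scale /=; ring.
Qed.

Lemma is_cderiveZ (c : R[i]) f x df : is_cderive f x df ->
  is_cderive (fun y => c * f y) x (c * df).
Proof.
by move=> /(is_cderiveM (is_cderive_cst c x)); rewrite mul0r add0r.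
Qed.

Lemma is_cderiveN f x df : is_cderive f x df ->
  is_cderive (fun y => - f y) x (- df).
Proof.
move=> /(is_cderiveZ (-1)); rewrite mulN1r.
by under eq_fun do rewrite mulN1r.
Qed.

Lemma is_cderive_sum (I : Type) (r : seq I) (f : I -> R -> R[i]) x df :
  (forall i, is_cderive (f i) x (df i)) ->
  is_cderive (fun y => \sum_(i <- r) f i y) x (\sum_(i <- r) df i).
Proof.
move=> fd; elim: r => [|i r ih].
  by rewrite big_nil; under eq_fun do rewrite big_nil; exact: is_cderive_cst.
by rewrite big_cons; under eq_fun do rewrite big_cons; exact: is_cderiveD.
Qed.

Lemma is_cderive_near f g x df : (\forall y \near x, f y = g y) ->
  is_cderive f x df -> is_cderive g x df.
Proof.
move=> fg [f1 f2]; split.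
- apply: near_eq_is_derive f1.
  by near=> y; congr complex.Re; near: y.
- apply: near_eq_is_derive f2.
  by near=> y; congr complex.Im; near: y.
Unshelve. all: by end_near. Qed.

Lemma is_cderive_unique f x df dg :
  is_cderive f x df -> is_cderive f x dg -> df = dg.
Proof.
move=> [f1 f2] [g1 g2]; apply: complex_ext.
- by rewrite -(@derive_val _ _ _ _ _ _ _ f1) (@derive_val _ _ _ _ _ _ _ g1).
- by rewrite -(@derive_val _ _ _ _ _ _ _ f2) (@derive_val _ _ _ _ _ _ _ g2).
Qed.

Lemma is_cderive_real (f : R -> R) x df : is_derive x 1 f df ->
  is_cderive (fun y => (f y)%:C) x df%:C.
Proof. by move=> fd; split => //=; exact: is_derive_cst. Qed.

End ComplexDerivative.

Section ComplexIntegral.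
Context {R : realType} {d : measure_display} {T : measurableType d}.
Variables (mu : {measure set T -> \bar R}) (D : set T).
Hypothesis mD : measurable D.
Implicit Types (f g : T -> R[i]).

Lemma eq_cintegrable f g : (forall x, D x -> f x = g x) ->
  cintegrable mu D f -> cintegrable mu D g.
Proof.
move=> fg [f1 f2]; split.
- by apply: eq_integrable f1 => // x /[!inE] Dx; rewrite fg.
- by apply: eq_integrable f2 => // x /[!inE] Dx; rewrite fg.
Qed.

Lemma eq_cintegral f g : (forall x, D x -> f x = g x) ->
  cintegral mu D f = cintegral mu D g.
Proof.
by move=> fg; congr (_ +i* _); apply: eq_Rintegral => x /[!inE] Dx; rewrite fg.
Qed.

Lemma cintegrableD f g : cintegrable mu D f -> cintegrable mu D g ->
  cintegrable mu D (fun x => f x + g x).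
Proof.
move=> [f1 f2] [g1 g2]; split.
- by apply: eq_integrable (integrableD mD f1 g1) => // x _; rewrite Re_add.
- by apply: eq_integrable (integrableD mD f2 g2) => // x _; rewrite Im_add.
Qed.

Lemma cintegrableZ (c : R[i]) f : cintegrable mu D f ->
  cintegrable mu D (fun x => c * f x).
Proof.
move=> [f1 f2]; split.
- apply: eq_integrable (integrableB mD (integrableZl mD (complex.Re c) f1)
    (integrableZl mD (complex.Im c) f2)) => // x _.
  by rewrite Re_mul.
- apply: eq_integrable (integrableD mD (integrableZl mD (complex.Re c) f2)
    (integrableZl mD (complex.Im c) f1)) => // x _.
  by rewrite Im_mul.
Qed.

Lemma cintegrableMr f (h : T -> R) : measurable_fun D h -> [bounded h x | x in D] ->
  cintegrable mu D f -> cintegrable mu D (fun x => f x * (h x)%:C).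
Proof.
move=> mh bh [f1 f2]; split.
- by apply: eq_integrable (integrableMl mD f1 mh bh) => // x _; rewrite Re_mulr.
- by apply: eq_integrable (integrableMl mD f2 mh bh) => // x _; rewrite Im_mulr.
Qed.

Lemma cintegralD f g : cintegrable mu D f -> cintegrable mu D g ->
  cintegral mu D (fun x => f x + g x) = cintegral mu D f + cintegral mu D g.
Proof.
move=> [f1 f2] [g1 g2]; rewrite /cintegral; apply: complex_ext.
- rewrite Re_add /= -RintegralD//.
  by apply: eq_Rintegral => x _; rewrite Re_add.
- rewrite Im_add /= -RintegralD//.
  by apply: eq_Rintegral => x _; rewrite Im_add.
Qed.

Lemma cintegralZ (c : R[i]) f : cintegrable mu D f ->
  cintegral mu D (fun x => c * f x) = c * cintegral mu D f.
Proof.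
move=> [f1 f2]; rewrite /cintegral; apply: complex_ext.
- rewrite Re_mul /= -!RintegralZl// -RintegralB//.
  + by apply: eq_Rintegral => x _; rewrite Re_mul.
  + exact: (integrableZl mD (complex.Re c) f1).
  + exact: (integrableZl mD (complex.Im c) f2).
- rewrite Im_mul /= -!RintegralZl// -RintegralD//.
  + by apply: eq_Rintegral => x _; rewrite Im_mul.
  + exact: (integrableZl mD (complex.Re c) f2).
  + exact: (integrableZl mD (complex.Im c) f1).
Qed.

Lemma cintegral_lincomb (c : R[i]) f g h :
  cintegrable mu D f -> cintegrable mu D g -> cintegrable mu D h ->
  cintegral mu D (fun x => c * f x - g x - h x) =
  c * cintegral mu D f - cintegral mu D g - cintegral mu D h.
Proof.
move=> fi gi hi.
have cf := cintegrableZ c fi.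
have ng := cintegrableZ (-1) gi; have nh := cintegrableZ (-1) hi.
transitivity (cintegral mu D (fun x => c * f x + -1 * g x + -1 * h x)).
  by apply: eq_cintegral => x _; rewrite !mulN1r.
rewrite (cintegralD (cintegrableD cf ng) nh) (cintegralD cf ng).
by rewrite !cintegralZ// !mulN1r.
Qed.

Lemma cintegrable0 : cintegrable mu D (fun=> 0).
Proof. by split; exact: integrable0. Qed.

End ComplexIntegral.

Section ComplexFubini.
Context {R : realType}.
Local Notation mu := (@lebesgue_measure R).
Implicit Types (F : R * R -> R[i]).

Lemma measurable_halfline : @measurable _ (measurableTypeR R) halfline.
Proof.
have -> : @halfline R = `]0, +oo[%classic.
  by apply/seteqP; split => x /=; rewrite in_itv/= andbT.
exact: measurable_itv.
Qed.

Lemma quadrantE : @quadrant R = halfline `*` halfline.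
Proof. by apply/seteqP; split => x. Qed.

Lemma measurable_quadrant :
  @measurable _ (measurableTypeR R * measurableTypeR R)%type quadrant.
Proof. by rewrite quadrantE; apply: measurableX; exact: measurable_halfline. Qed.

Let restrict_slice (f : R * R -> \bar R) (x : R) : halfline x ->
  (fun y => (f \_ quadrant) (x, y)) = (fun y => f (x, y)) \_ halfline.
Proof.
move=> x0; apply/funext => y; rewrite !patchE /=.
have [y0|y0] := pselect (halfline y).
  by rewrite !mem_set.
by rewrite !memNset// => -[].
Qed.

Section Slices.
Variable f : R * R -> R.
Hypothesis fi : (mu \x mu)%E.-integrable quadrant (EFin \o f).

Let fqi : (mu \x mu)%E.-integrable setT ((EFin \o f) \_ quadrant).
Proof.
exact: (iffLR (integrable_mkcond (mu := (mu \x mu)%E) _ measurable_quadrant) fi).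
Qed.

Lemma ae_integrable_quadrant :
  {ae mu, forall x, 0 < x -> mu.-integrable halfline (fun y => (f (x, y))%:E)}.
Proof.
apply: filterS (ae_integrable1 fqi) => x /= + x0.
rewrite restrict_slice// => fx.
exact: (iffRL (integrable_mkcond (mu := mu) _ measurable_halfline)).
Qed.

Hypothesis fsi :
  forall x, 0 < x -> mu.-integrable halfline (fun y => (f (x, y))%:E).

(** Since every slice over x > 0 is integrable, and not only almost every one, the inner integrals
    are finite and [fine] loses nothing: the equality holds pointwise. *)
Let fubiniE : fubini_F mu ((EFin \o f) \_ quadrant) =
  (fun x => (Rintegral mu halfline (fun y => f (x, y)))%:E) \_ halfline.
Proof.
apply/funext => x; rewrite /fubini_F patchE.
case: ifPn => [/[!inE] x0|/negP x0].
  rewrite restrict_slice// -integral_mkcond /Rintegral fineK//.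
  by apply: integrable_fin_num => //; [exact: measurable_halfline|exact: fsi].
under eq_integral => y _.
  rewrite patchE memNset; last by move=> [/= xx _]; apply: x0; rewrite inE.
  over.
exact: integral0.
Qed.

Lemma integrable_quadrant1 : mu.-integrable halfline
  (fun x => (Rintegral mu halfline (fun y => f (x, y)))%:E).
Proof.
apply: (iffRL (integrable_mkcond (mu := mu) _ measurable_halfline)).
by rewrite -fubiniE; exact: integrable_fubini_F.
Qed.

Lemma Rintegral_quadrant :
  Rintegral (mu \x mu)%E quadrant f =
  Rintegral mu halfline (fun x => Rintegral mu halfline (fun y => f (x, y))).
Proof.
congr fine; rewrite integral_mkcond.
apply: etrans (esym (integral12_prod_meas1 fqi)) _.
rewrite [RHS]integral_mkcond; apply: eq_integral => x _.
exact: (congr1 (@^~ x) fubiniE).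
Qed.

End Slices.

Lemma integrable_quadrant_swap (f : R * R -> R) :
  (mu \x mu)%E.-integrable quadrant (EFin \o f) ->
  (mu \x mu)%E.-integrable quadrant (fun u => (f (u.2, u.1))%:E).
Proof.
move=> fi; have mq := measurable_quadrant.
apply: (iffRL (integrable_mkcond (mu := (mu \x mu)%E) _ mq)).
have fqi : (mu \x mu)%E.-integrable setT ((EFin \o f) \_ quadrant).
  exact: (iffLR (integrable_mkcond (mu := (mu \x mu)%E) _ mq) fi).
have -> : (fun u : R * R => (f (u.2, u.1))%:E) \_ quadrant =
    ((EFin \o f) \_ quadrant) \o (fun u => (u.2, u.1)).
  apply/funext => -[x y]; rewrite /= !patchE.
  by congr (if _ then _ else _); apply/idP/idP; rewrite !inE => -[].
have mf := measurable_int _ fqi.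
apply/integrable12ltyP.
  have mswap := @measurable_swap _ _ (measurableTypeR R) (measurableTypeR R).
  by refine (measurable_comp measurableT _ mf mswap) => ?.
exact: (iffLR (integrable21ltyP _ _ mf) fqi).
Qed.

Lemma Rintegral_quadrant_swap (f : R * R -> R) :
  (mu \x mu)%E.-integrable quadrant (EFin \o f) ->
  Rintegral (mu \x mu)%E quadrant (fun u => f (u.2, u.1)) =
  Rintegral (mu \x mu)%E quadrant f.
Proof.
move=> fi; have mq := measurable_quadrant.
have gi := integrable_quadrant_swap fi.
have fqi : (mu \x mu)%E.-integrable setT ((EFin \o f) \_ quadrant).
  exact: (iffLR (integrable_mkcond (mu := (mu \x mu)%E) _ mq) fi).
have gqi : (mu \x mu)%E.-integrable setT
    ((fun u => (f (u.2, u.1))%:E) \_ quadrant).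
  exact: (iffLR (integrable_mkcond (mu := (mu \x mu)%E) _ mq) gi).
congr fine; rewrite integral_mkcond [in RHS]integral_mkcond.
apply: etrans (etrans _ (integral21_prod_meas1 fqi)).
  exact: esym (integral12_prod_meas1 gqi).
apply: eq_integral => x _; apply: eq_integral => y _; rewrite !patchE.
by congr (if _ then _ else _); apply/idP/idP; rewrite !inE => -[].
Qed.
End ComplexFubini.

(** * Bounded multipliers and the derivative of a Stieltjes transform *)

Section Multipliers.
Context {R : realType}.
Local Notation mu := (@lebesgue_measure R).

Lemma bounded_on {T : Type} (D : set T) (h : T -> R) (M : R) :
  (forall x, D x -> `|h x| <= M) -> [bounded h x | x in D].
Proof.
move=> hM; exists M; split; first exact: num_real.
by move=> N MN x Dx; apply: le_trans (hM _ Dx) (ltW MN).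
Qed.

(** Inversion agrees with the real power of exponent -1 on nonnegative numbers, 0 included, and real
    powers are measurable. *)
Lemma measurable_fun_invr d (T : measurableType d) (D : set T) (h : T -> R) :
  (forall x, D x -> 0 <= h x) ->
  measurable_fun D h -> measurable_fun D (fun x => (h x)^-1).
Proof.
move=> h0 mh; apply: (@eq_measurable_fun _ _ _ _ _ (fun x => h x `^ (-1))).
  by move=> x /[!inE] Dx; rewrite powR_inv1// h0.
exact: (measurableT_comp (measurable_powR (-1)) mh).
Qed.

Lemma measurable_kernel (t : R) (m : nat) : 0 < t ->
  @measurable_fun _ _ (measurableTypeR R) R halfline
    (fun x => ((x + t) ^+ m)^-1).
Proof.
move=> t0; apply: measurable_fun_invr.
  by move=> x x0; rewrite exprn_ge0// addr_ge0// ltW.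
by apply: measurable_funX; apply: measurable_funD.
Qed.

Lemma bounded_kernel (t : R) (m : nat) : 0 < t ->
  [bounded ((x + t) ^+ m)^-1 | x in @halfline R].
Proof.
move=> t0; apply: (@bounded_on _ _ _ ((t ^+ m)^-1)) => x x0.
have xt0 : 0 < x + t by rewrite addr_gt0.
rewrite ger0_norm ?invr_ge0 ?exprn_ge0 ?(ltW xt0)//.
rewrite lef_pV2 ?posrE ?exprn_gt0// lerXn2r ?nnegrE ?(ltW t0) ?(ltW xt0)//.
by rewrite lerDr ltW.
Qed.

End Multipliers.

Section FiniteMoments.
Context {R : realType}.
Local Notation mu := (@lebesgue_measure R).
Variable w : R -> R[i].
Hypothesis wfin : forall k, cintegrable mu halfline (fun x => w x * (x ^+ k)%:C).
Let mh := @measurable_halfline R.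

Lemma cintegrable_kernel (t : R) (k m : nat) : 0 < t ->
  cintegrable mu halfline (fun x => w x * (x ^+ k / (x + t) ^+ m)%:C).
Proof.
move=> t0.
apply: (eq_cintegrable mh) (cintegrableMr mh (measurable_kernel m t0)
  (bounded_kernel m t0) (wfin k)) => x _.
by rewrite rmorphM /= mulrA.
Qed.

Lemma is_cderive_stieltjes (t : R) (k : nat) : 0 < t ->
  is_cderive (fun t' => cintegral mu halfline (fun x => w x * (x ^+ k / (x + t'))%:C))
    t (- cintegral mu halfline (fun x => w x * (x ^+ k / (x + t) ^+ 2)%:C)).
Proof.
move=> t0.
have real_case (u : R -> R) :
    mu.-integrable halfline (fun x => (u x)%:E) ->
    is_derive t 1 (fun t' => Rintegral mu halfline (fun x => u x / (x + t')))
      (- Rintegral mu halfline (fun x => u x / (x + t) ^+ 2)).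
  move=> ui.
  have int_m m (t' : R) : 0 < t' -> mu.-integrable halfline
      (fun x => (u x / (x + t') ^+ m)%:E).
    move=> t'0; apply: eq_integrable (integrableMl mh ui
      (measurable_kernel m t'0) (bounded_kernel m t'0)) => // x _.
  have It : `]t / 2, t + 1[%classic t by rewrite /= in_itv/=; lra.
  have I0 x : `]t / 2, t + 1[%classic x -> 0 < x.
    by rewrite /= in_itv/=; lra.
  have dk (x y : R) : 0 < x -> 0 < y ->
      is_derive x 1 (fun x' : R => u y / (y + x')) (- (u y / (y + x) ^+ 2)).
    move=> x0 y0; have yx : y + x != 0 by rewrite gt_eqF// addr_gt0.
    apply: is_derive_eq.
    by rewrite /GRing.scale /=; field.
  (* On the chosen neighbourhood of [t] one has y + x > t / 2, so [G] dominates the derivative of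
     the integrand uniformly in x. *)
  pose G y := `|u y| / (t / 2) ^+ 2.
  have intG : mu.-integrable halfline (EFin \o G).
    apply: eq_integrable (integrableZr mh ((t / 2) ^+ 2)^-1 (integrable_norm ui)) => //.
  have G0 y : 0 <= G y by rewrite /G divr_ge0// exprn_ge0//; lra.
  have intf (x : R) : `]t / 2, t + 1[%classic x ->
      mu.-integrable halfline (EFin \o (fun y => u y / (y + x))).
    move=> /I0 x0; exact: eq_integrable (int_m 1%N x x0).
  have derf (x y : R) : `]t / 2, t + 1[%classic x -> halfline y ->
      derivable (fun x' : R => u y / (y + x')) x 1.
    by move=> /I0 x0 y0; have [] := dk _ _ x0 y0.
  have Gub (x y : R) : `]t / 2, t + 1[%classic x -> halfline y ->
      `|partial1of2 (fun x' y : R => u y / (y + x')) x y| <= G y.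
    move=> Ix y0; have x0 := I0 _ Ix.
    rewrite partial1of2E (@derive_val _ _ _ _ _ _ _ (dk _ _ x0 y0)).
    have yx0 : 0 < y + x by rewrite addr_gt0.
    have t20 : 0 < t / 2 by lra.
    rewrite normrN normrM /G ler_wpM2l// ger0_norm ?invr_ge0 ?exprn_ge0 ?(ltW yx0)//.
    rewrite lef_pV2 ?posrE ?exprn_gt0// lerXn2r ?nnegrE ?(ltW yx0) ?(ltW t20)//.
    by move: Ix y0; rewrite /halfline /= in_itv/=; lra.
  apply: DeriveDef.
    exact: (derivable_under_integral mh It intf derf G0 intG Gub).
  rewrite -derive1E.
  rewrite (differentiation_under_integral mh It intf derf G0 intG Gub).
  rewrite -mulN1r -RintegralZl//; last exact: int_m.
  apply: eq_Rintegral => y /[!inE] y0.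
  rewrite partial1of2E (@derive_val _ _ _ _ _ _ _ (dk _ _ t0 y0)).
  by rewrite mulN1r.
have [wR wI] := wfin k; split.
- under eq_fun do (rewrite /cintegral /=; under eq_Rintegral do rewrite Re_mulr mulrA).
  rewrite /cintegral /=; under eq_Rintegral do rewrite Re_mulr mulrA.
  by apply: real_case; apply: eq_integrable wR => // x _; rewrite Re_mulr.
- under eq_fun do (rewrite /cintegral /=; under eq_Rintegral do rewrite Im_mulr mulrA).
  rewrite /cintegral /=; under eq_Rintegral do rewrite Im_mulr mulrA.
  by apply: real_case; apply: eq_integrable wI => // x _; rewrite Im_mulr.
Qed.

End FiniteMoments.

(** * Improper integrals of derivatives *)

Section ImproperFTC.
Context {R : realType}.
Local Notation mu := (@lebesgue_measure R).

(** The fundamental theorem applies on each compact interval [u n, v n], and dominated convergence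
    with bound |f| passes to the limit. Limits of [F] are asked only along the two sequences, and a
    constant sequence accounts for an endpoint that belongs to [D]. *)
Lemma Rintegral_FTC_exhaustion (D : set R) (f F : R -> R) (u v : nat -> R)
    (A B : R) :
  @measurable _ (measurableTypeR R) D ->
  mu.-integrable D (EFin \o f) ->
  (forall x, D x -> is_derive x 1 F (f x)) ->
  (forall x, D x -> {for x, continuous f}) ->
  (forall n, u n < v n) ->
  (forall n x, u n <= x <= v n -> D x) ->
  (forall x, D x -> \forall n \near \oo, u n <= x <= v n) ->
  F (u n) @[n --> \oo] --> A -> F (v n) @[n --> \oo] --> B ->
  Rintegral mu D f = B - A.
Proof.
move=> mD fi dF cf uv uvD Duv FA FB.
have DE n : D `&` `[u n, v n] = `[u n, v n]%classic.
  by apply: setIidr => x; rewrite /= in_itv/=; exact: uvD.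
pose f_ n : R -> \bar R := (EFin \o f) \_ `[u n, v n].
have mf := measurable_int _ fi.
have mf_ n : @measurable_fun _ _ (measurableTypeR R) _ D (f_ n).
  by apply/measurable_restrict => //; apply: measurable_funS mf => // x [].
have f_f : {ae mu, forall x, D x -> f_ ^~ x @ \oo --> (f x)%:E}.
  apply: aeW => x Dx; apply: cvg_near_cst.
  near=> n; rewrite /f_ patchE mem_set//=.
  by rewrite in_itv/=; near: n; exact: Duv.
have f_g : {ae mu, forall x n, D x -> (`|f_ n x| <= `|(f x)%:E|)%E}.
  apply: aeW => x n Dx; rewrite /f_ patchE.
  by case: ifPn => //= _; rewrite normr0 lee_fin.
have [_ _] := dominated_convergence mD mf_ mf f_f (integrable_abse fi) f_g.
have int_f n : (\int[mu]_(x in D) f_ n x)%E = (F (v n) - F (u n))%:E.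
  rewrite -integral_mkcondr DE.
  have cF x : D x -> {for x, continuous F}.
    move=> Dx; apply: differentiable_continuous; apply/derivable1_diffP.
    by have [] := dF _ Dx.
  rewrite (@continuous_FTC2 _ f F) ?EFinB//.
  - apply: continuous_in_subspaceT => x /[!inE] /= /[!in_itv] /= xuv.
    by apply: cf; exact: uvD xuv.
  - split.
    + move=> x; rewrite in_itv/= => /andP[ux xv].
      have Dx : D x by apply: (uvD n); rewrite !ltW.
      by have [] := dF _ Dx.
    + apply: cvg_at_right_filter; apply: cF.
      by apply: (uvD n); rewrite lexx ltW.
    + apply: cvg_at_left_filter; apply: cF.
      by apply: (uvD n); rewrite lexx ltW.
  - move=> x; rewrite in_itv/= => /andP[ux xv].
    have Dx : D x by apply: (uvD n); rewrite !ltW.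
    by rewrite derive1E (@derive_val _ _ _ _ _ _ _ (dF _ Dx)).
under eq_fun do rewrite int_f.
move=> limf; rewrite /Rintegral.
have limF : (F (v n) - F (u n))%:E @[n --> \oo] --> (B - A)%:E.
  by apply/cvg_EFin; [exact: nearW|exact: cvgB].
by rewrite -(cvg_unique _ limF limf).
Unshelve. all: by end_near. Qed.

End ImproperFTC.

Section ComplexFTC.
Context {R : realType}.
Local Notation mu := (@lebesgue_measure R).

Definition ccvg (u : nat -> R[i]) (l : R[i]) :=
  (complex.Re (u n) @[n --> \oo] --> complex.Re l) /\
  (complex.Im (u n) @[n --> \oo] --> complex.Im l).

Lemma ccvgZ (c : R[i]) u l : ccvg u l -> ccvg (fun n => c * u n) (c * l).
Proof.
move=> [u1 u2]; split.
- under eq_fun do rewrite Re_mul; rewrite Re_mul.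
  by apply: cvgB; apply: cvgMr.
- under eq_fun do rewrite Im_mul; rewrite Im_mul.
  by apply: cvgD; apply: cvgMr.
Qed.

Lemma is_cderive_continuous (f : R -> R[i]) x df : is_cderive f x df ->
  {for x, continuous (fun y => complex.Re (f y))} /\
  {for x, continuous (fun y => complex.Im (f y))}.
Proof.
by move=> [[f1 _] [f2 _]]; split; apply: differentiable_continuous;
  apply/derivable1_diffP.
Qed.

Lemma cintegral_FTC_exhaustion (D : set R) (f F : R -> R[i]) (u v : nat -> R)
    (A B : R[i]) :
  @measurable _ (measurableTypeR R) D ->
  cintegrable mu D f ->
  (forall x, D x -> is_cderive F x (f x)) ->
  (forall x, D x -> exists df, is_cderive f x df) ->
  (forall n, u n < v n) ->
  (forall n x, u n <= x <= v n -> D x) ->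
  (forall x, D x -> \forall n \near \oo, u n <= x <= v n) ->
  ccvg (F \o u) A -> ccvg (F \o v) B ->
  cintegral mu D f = B - A.
Proof.
move=> mD [f1 f2] dF df uv uvD Duv [A1 A2] [B1 B2].
apply: complex_ext.
- rewrite Re_add Re_opp.
  apply: (Rintegral_FTC_exhaustion (F := fun y => complex.Re (F y)) mD f1
    _ _ uv uvD Duv A1 B1) => x Dx.
    by have [] := dF _ Dx.
  by have [dfx /is_cderive_continuous[]] := df _ Dx.
- rewrite Im_add Im_opp.
  apply: (Rintegral_FTC_exhaustion (F := fun y => complex.Im (F y)) mD f2
    _ _ uv uvD Duv A2 B2) => x Dx.
    by have [] := dF _ Dx.
  by have [dfx /is_cderive_continuous[]] := df _ Dx.
Qed.

Lemma cintegral_setU (A B : set R) (f : R -> R[i]) :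
  @measurable _ (measurableTypeR R) A -> @measurable _ (measurableTypeR R) B ->
  [disjoint A & B] -> cintegrable mu (A `|` B) f ->
  cintegral mu (A `|` B) f = cintegral mu A f + cintegral mu B f.
Proof.
move=> mA mB AB [f1 f2]; apply: complex_ext.
- by rewrite Re_add /=; exact: Rintegral_setU f1 AB.
- by rewrite Im_add /=; exact: Rintegral_setU f2 AB.
Qed.

Lemma cintegrableS (A B : set R) (f : R -> R[i]) :
  @measurable _ (measurableTypeR R) A -> @measurable _ (measurableTypeR R) B ->
  B `<=` A -> cintegrable mu A f -> cintegrable mu B f.
Proof.
by move=> mA mB AB [f1 f2]; split; [exact: integrableS f1|exact: integrableS f2].
Qed.

End ComplexFTC.

(** * Complex powers and one-variable integration by parts against a weight *)

Section ComplexPower.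
Context {R : realType}.
Implicit Types (x : R) (z : R[i]).

Lemma Re_cpow x z :
  complex.Re (cpow x z) = expR (complex.Re z * ln x) * cos (complex.Im z * ln x).
Proof. by rewrite /cpow Re_mul /= mul0r subr0. Qed.

Lemma Im_cpow x z :
  complex.Im (cpow x z) = expR (complex.Re z * ln x) * sin (complex.Im z * ln x).
Proof. by rewrite /cpow Im_mul /= mul0r addr0. Qed.

Lemma cpowD1 x z : 0 < x -> cpow x (z + 1) = cpow x z * x%:C.
Proof.
move=> x0; apply: complex_ext.
- rewrite Re_mulr !Re_cpow Re_add Im_add /= addr0 mulrDl mul1r expRD lnK//.
  by rewrite mulrAC.
- rewrite Im_mulr !Im_cpow Re_add Im_add /= addr0 mulrDl mul1r expRD lnK//.
  by rewrite mulrAC.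
Qed.

Lemma cpow_neq0 x z : cpow x z != 0.
Proof.
rewrite mulf_neq0//.
  by rewrite -[0]/(0%:C) (inj_eq (@complexI R)) gt_eqF// expR_gt0.
apply/negP => /eqP[c0 s0].
have := cos2Dsin2 (complex.Im z * ln x).
by rewrite c0 s0 expr0n /= addr0 => /eqP; rewrite eq_sym oner_eq0.
Qed.

Lemma is_cderive_cpow x z : 0 < x ->
  is_cderive (fun y => cpow y z) x (z * cpow x z * (x^-1)%:C).
Proof.
move=> x0; have dln := is_derive1_ln x0; split.
- under eq_fun do rewrite Re_cpow.
  apply: is_derive_eq.
  rewrite /GRing.scale /= Re_mulr Re_mul Re_cpow Im_cpow; ring.
- under eq_fun do rewrite Im_cpow.
  apply: is_derive_eq.
  rewrite /GRing.scale /= Im_mulr Im_mul Re_cpow Im_cpow; ring.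
Qed.

Lemma is_cderive_cpowD1 x z : 0 < x ->
  is_cderive (fun y => cpow y (z + 1)) x ((z + 1) * cpow x z).
Proof.
move=> x0; have := is_cderive_cpow (z + 1) x0.
rewrite cpowD1// mulrA -mulrA -rmorphM /= mulfV ?gt_eqF//.
by rewrite rmorph1 mulr1.
Qed.

Lemma cpow_bound x z : 0 < x ->
  `|complex.Re (cpow x z)| <= x `^ complex.Re z /\
  `|complex.Im (cpow x z)| <= x `^ complex.Re z.
Proof.
move=> x0; rewrite Re_cpow Im_cpow /powR gt_eqF// !normrM.
rewrite ger0_norm ?expR_ge0//; split; apply: ler_piMr; rewrite ?expR_ge0//.
- by rewrite ler_norml cos_geN1 cos_le1.
- by rewrite ler_norml sin_geN1 sin_le1.
Qed.

End ComplexPower.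

Section WeightByParts.
Context {R : realType}.
Local Notation mu := (@lebesgue_measure R).
Variables (c kappa : R[i]) (y : R) (k : nat).
Hypotheses (hc : -1 < complex.Re c) (y0 : 0 < y).

Let g (x : R) := expR (- x) * (x ^+ k / (x + y)).
(** The product to be integrated by parts. The exponent is c + 1 so that [F] vanishes at 0 when Re c
    > -1; [f] below is its derivative with x^c e^(-x) taken out, that is, the integrand without the
    step of the weight. *)
Let F (x : R) := cpow x (c + 1) * (g x)%:C.

Let f (x : R) := cpow x c * (expR (- x))%:C *
  ((c + 1 + k%:R) * (x ^+ k / (x + y))%:C - (x ^+ k.+1 / (x + y))%:C
   - (x ^+ k.+1 / (x + y) ^+ 2)%:C).

Let is_derive_frac (x : R) (j m : nat) : 0 < x ->
  is_derive x 1 (fun z => z ^+ j / (z + y) ^+ m)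
   (j%:R * x ^+ j.-1 / (x + y) ^+ m - m%:R * x ^+ j / (x + y) ^+ m.+1).
Proof.
move=> x0; have xy : x + y != 0 by rewrite gt_eqF// addr_gt0.
have dX (e : R) (n : nat) :
    is_derive x 1 (fun z : R => (z + e) ^+ n) (n%:R * (x + e) ^+ n.-1).
  have -> : (fun z : R => (z + e) ^+ n) = (id + cst e) ^+ n.
    by apply/funext => z; rewrite exprfctE.
  apply: is_derive_eq.
  by rewrite /GRing.scale /= addr0 mulr1.
have dj := dX 0 j; rewrite addr0 in dj.
have dm := @is_deriveV R (fun z => (z + y) ^+ m) x _ 1 (expf_neq0 m xy) (dX y m).
have -> : (fun z => z ^+ j / (z + y) ^+ m) =
    (fun z => (z + 0) ^+ j) * (fun z => ((z + y) ^+ m)^-1).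
  by apply/funext => z; rewrite -[z in z ^+ j]addr0.
apply: is_derive_eq.
rewrite /GRing.scale /= addr0.
(* The case m = 0 is apart because [m.-1] is then truncated; the term that contains it has
   coefficient 0. *)
case: m {dm} => [|m]; first by rewrite !mul0r !mulr0 subr0 add0r; ring.
by rewrite /= !exprS; field; rewrite xy expf_neq0.
Qed.

Let Fderive (x : R) : 0 < x -> is_cderive F x (f x).
Proof.
move=> x0.
have dE : is_derive x 1 (fun z : R => expR (- z)) (- expR (- x)).
  by apply: is_derive_eq; rewrite /GRing.scale /=; ring.
have dq := is_derive_frac k 1 x0.
have dg : is_derive x 1 g (expR (- x) *
    (k%:R * x ^+ k.-1 / (x + y) - x ^+ k / (x + y) ^+ 2 - x ^+ k / (x + y))).
  rewrite /g.
  have -> : (fun z => expR (- z) * (z ^+ k / (z + y))) =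
      (fun z => expR (- z)) * (fun z => z ^+ k / (z + y) ^+ 1).
    by apply/funext => z; rewrite -[z + y]expr1.
  apply: is_derive_eq.
  by rewrite /GRing.scale /= expr1 mul1r; ring.
have := is_cderiveM (is_cderive_cpowD1 c x0) (is_cderive_real dg).
congr (is_cderive _ _ _).
rewrite cpowD1// /g /f !(rmorphM, rmorphB) /= rmorph_nat.
case: k => [|j]; last by rewrite /= !(exprS x) !rmorphM /=; ring.
by rewrite !expr1 !expr0 rmorph1; ring.
Qed.

Let fderive (x : R) : 0 < x -> exists df, is_cderive f x df.
Proof.
move=> x0.
have dE : is_derive x 1 (fun z : R => expR (- z)) (- expR (- x)).
  by apply: is_derive_eq; rewrite /GRing.scale /=; ring.
have q1 := is_derive_frac k 1 x0.
have q2 := is_derive_frac k.+1 1 x0.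
have q3 := is_derive_frac k.+1 2 x0.
eexists; rewrite /f.
apply: is_cderiveM.
  exact: is_cderiveM (is_cderive_cpow c x0) (is_cderive_real dE).
apply: is_cderiveD; last exact: is_cderiveN (is_cderive_real q3).
apply: is_cderiveD; last exact: is_cderiveN (is_cderive_real q2).
exact: is_cderiveZ (is_cderive_real q1).
Qed.

Let h (x : R) := x `^ (complex.Re c + 1) * g x.

Let g_ge0 (x : R) : 0 < x -> 0 <= g x.
Proof.
move=> x0; rewrite /g mulr_ge0 ?expR_ge0// divr_ge0 ?exprn_ge0 ?ltW//.
by rewrite addr_gt0.
Qed.

Let F_bound (x : R) : 0 < x ->
  `|complex.Re (F x)| <= h x /\ `|complex.Im (F x)| <= h x.
Proof.
move=> x0; rewrite /F Re_mulr Im_mulr.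
rewrite [X in X <= _ /\ _]normrM [X in _ /\ X <= _]normrM (ger0_norm (g_ge0 x0)).
have [] := cpow_bound (c + 1) x0; rewrite Re_add /= => h1 h2.
by split; apply: ler_wpM2r => //; exact: g_ge0.
Qed.

Let F_cvg0 (u : nat -> R) : (forall n, 0 < u n) ->
  h (u n) @[n --> \oo] --> 0 -> ccvg (F \o u) 0.
Proof.
move=> u0 hu; have hNu : - h (u n) @[n --> \oo] --> 0.
  by rewrite -oppr0; exact: cvgN.
split => /=.
- apply: squeeze_cvgr hNu hu; apply: nearW => n.
  by have [+ _] := F_bound (u0 n); rewrite ler_norml.
- apply: squeeze_cvgr hNu hu; apply: nearW => n.
  by have [_ +] := F_bound (u0 n); rewrite ler_norml.
Qed.

Let h_cvg_at0 (u : nat -> R) : (forall n, 0 < u n) -> u n @[n --> \oo] --> 0 ->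
  h (u n) @[n --> \oo] --> 0.
Proof.
move=> u0 u_cvg.
have a0 : 0 < complex.Re c + 1 by rewrite -ltrBlDr sub0r.
have p_cvg : (u n) `^ (complex.Re c + 1) * y^-1 @[n --> \oo] --> 0.
  rewrite -(mul0r y^-1); apply: cvgMl.
  by have /cvg_at_rightP := powR_cvg0 a0; apply; split.
apply: squeeze_cvgr (cvg_cst 0) p_cvg.
near=> n; have un0 := u0 n.
have un1 : u n <= 1.
  by near: n; apply: (cvgr_le 0).
have uny0 : 0 < u n + y by rewrite addr_gt0.
have xk1 : u n ^+ k / (u n + y) <= y^-1.
  rewrite -[leRHS]mul1r; apply: ler_pM.
  - by rewrite exprn_ge0// ltW.
  - by rewrite invr_ge0 ltW.
  - by rewrite exprn_ile1// ltW.
  - by rewrite lef_pV2 ?posrE// lerDr ltW.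
rewrite /h mulr_ge0 ?powR_ge0 ?g_ge0//= ler_wpM2l ?powR_ge0// /g.
rewrite -[leRHS]mul1r; apply: ler_pM.
- exact: expR_ge0.
- by rewrite divr_ge0 ?exprn_ge0// ltW.
- by rewrite expR_le1 oppr_le0 ltW.
- exact: xk1.
Unshelve. all: by end_near. Qed.

Let h_cvg_aty (u : nat -> R) : (forall n, 0 < u n) ->
  u n @[n --> \oo] --> +oo -> h (u n) @[n --> \oo] --> 0.
Proof.
move=> u0 u_cvg.
have [N hN] : exists N : nat, complex.Re c + 1 <= N%:R.
  exists (Num.bound `|complex.Re c + 1|).
  by rewrite (le_trans (ler_norm _))// ltW// archi_boundP.
(* For x >= 1 the power x^(Re c + 1) is at most x^N, and e^x >= x^(N+k+1) / (N+k+1)! gives x^(N+k)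
   e^(-x) <= (N+k+1)! / x. With 1/(x+y) <= 1/y this bounds [h] by M / x. *)
pose M := ((N + k).+1`!%:R / y : R).
have p_cvg : M * (u n)^-1 @[n --> \oo] --> 0.
  rewrite -(mulr0 M); apply: cvgMr.
  by apply/gtr0_cvgV0; [exact: nearW|].
apply: squeeze_cvgr (cvg_cst 0) p_cvg.
near=> n; have un0 := u0 n.
have un1 : 1 <= u n by near: n; move/cvgryPge : u_cvg; exact.
rewrite /h mulr_ge0 ?powR_ge0 ?g_ge0//=.
have p1 : (u n) `^ (complex.Re c + 1) <= u n ^+ N.
  by rewrite -powR_mulrn ?(ltW un0)// ler_powR.
have p2 : (u n + y)^-1 <= y^-1.
  by rewrite lef_pV2 ?posrE ?addr_gt0// lerDr (ltW un0).
have p3 : u n ^+ (N + k) * expR (- u n) <= (N + k).+1`!%:R / u n.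
  rewrite expRN ler_pdivlMr// mulrAC -exprSr ler_pdivrMr ?expR_gt0//.
  rewrite mulrC -ler_pdivrMr ?ltr0n ?fact_gt0//.
  apply: le_trans (expR_ge1Dxn (N + k) (ltW un0)).
  by rewrite lerDr.
have -> : u n `^ (complex.Re c + 1) * g (u n) =
    u n `^ (complex.Re c + 1) * (u n ^+ k * expR (- u n)) / (u n + y).
  by rewrite /g; ring.
have -> : M / u n = (N + k).+1`!%:R / u n / y by rewrite /M mulrAC.
apply: ler_pM.
- by rewrite !mulr_ge0 ?powR_ge0 ?expR_ge0 ?exprn_ge0// ltW.
- by rewrite invr_ge0 ltW// addr_gt0.
- apply: le_trans p3; rewrite exprD -mulrA; apply: ler_wpM2r => //.
  by rewrite mulr_ge0 ?expR_ge0 ?exprn_ge0// ltW.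
- exact: p2.
Unshelve. all: by end_near. Qed.

(* Apply the fundamental theorem to [F] on [(0, s]] and to [(1 - kappa) F] on
   [(s, oo)]: keeping the factor [1 - kappa], which may vanish, makes the
   integrability of the weighted moments sufficient. *)
Lemma weight_by_parts (s : R) : 0 < s ->
  (forall j, cintegrable mu halfline (fun x => weight c kappa s x * (x ^+ j)%:C)) ->
  cintegral mu halfline (fun x => weight c kappa s x *
    ((c + 1 + k%:R) * (x ^+ k / (x + y))%:C - (x ^+ k.+1 / (x + y))%:C
      - (x ^+ k.+1 / (x + y) ^+ 2)%:C)) =
  jump c kappa s * (s ^+ k / (s + y))%:C.
Proof.
move=> s0 wfin.
have mh := @measurable_halfline R.
pose A := `]0, s]%classic : set R; pose B := `]s, +oo[%classic : set R.
have mA : @measurable _ (measurableTypeR R) A by exact: measurable_itv.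
have mB : @measurable _ (measurableTypeR R) B by exact: measurable_itv.
have hAB : @halfline R = A `|` B.
  apply/seteqP; split => x; rewrite /halfline /A /B /= !in_itv /= andbT.
    by move=> x0; case: (leP x s) => xs; [left; rewrite x0|right].
  by case=> [/andP[]//|]; exact: lt_trans.
have dAB : [disjoint A & B].
  by apply/disj_setPS => x; rewrite /A /B /= !in_itv/= andbT => -[/andP[_ /le_gtF ->]].
have wi : cintegrable mu halfline (fun x => weight c kappa s x *
    ((c + 1 + k%:R) * (x ^+ k / (x + y))%:C - (x ^+ k.+1 / (x + y))%:C
      - (x ^+ k.+1 / (x + y) ^+ 2)%:C)).
  have i1 := cintegrableZ mh (c + 1 + k%:R) (cintegrable_kernel wfin k 1 y0).
  have i2 := cintegrableZ mh (-1) (cintegrable_kernel wfin k.+1 1 y0).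
  have i3 := cintegrableZ mh (-1) (cintegrable_kernel wfin k.+1 2 y0).
  apply: (eq_cintegrable mh) (cintegrableD mh (cintegrableD mh i1 i2) i3) => x _.
  by rewrite expr1; ring.
rewrite hAB in wi; rewrite hAB (cintegral_setU mA mB dAB wi).
have wiA := cintegrableS (measurableU _ _ mA mB) mA (@subsetUl _ _ _) wi.
have wiB := cintegrableS (measurableU _ _ mA mB) mB (@subsetUr _ _ _) wi.
have wA x : A x -> weight c kappa s x *
    ((c + 1 + k%:R) * (x ^+ k / (x + y))%:C - (x ^+ k.+1 / (x + y))%:C
      - (x ^+ k.+1 / (x + y) ^+ 2)%:C) = f x.
  rewrite /A /= in_itv/= => /andP[x0 xs].
  by rewrite /weight ltNge xs /= mulr0 subr0 mul1r.
have wB x : B x -> weight c kappa s x *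
    ((c + 1 + k%:R) * (x ^+ k / (x + y))%:C - (x ^+ k.+1 / (x + y))%:C
      - (x ^+ k.+1 / (x + y) ^+ 2)%:C) = (1 - kappa) * f x.
  rewrite /B /= in_itv/= andbT => sx.
  by rewrite /weight sx /= mulr1 /f !mulrA.
rewrite (eq_cintegral mu wA) (eq_cintegral mu wB).
have fA := eq_cintegrable mA wA wiA.
have fB := eq_cintegrable mB wB wiB.
(* [u1] decreases to 0 and the factor s / 2 keeps it strictly below s; [u2] decreases to s inside
   the open end of B. Since [u2] is at most s + 1, the offset in [v2] guarantees u2 n < v2 n. *)
pose u1 (n : nat) := s / 2 * n.+1%:R^-1; pose u2 (n : nat) := s + n.+1%:R^-1.
pose v2 (n : nat) := s + 1 + n.+1%:R.
have u1_gt0 n : 0 < u1 n by rewrite !divr_gt0.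
have u2_gts n : s < u2 n by rewrite ltrDl invr_gt0.
have u1_cvg : u1 n @[n --> \oo] --> 0.
  by rewrite -(mulr0 (s / 2)); apply: cvgMr; exact: cvg_harmonic.
have u2_cvg : u2 n @[n --> \oo] --> s.
  by rewrite -[X in _ --> X]addr0; apply: cvgD; [exact: cvg_cst|exact: cvg_harmonic].
have v2_cvg : v2 n @[n --> \oo] --> +oo.
  apply/cvgryPge => M; near=> n.
  apply: (@le_trans _ _ n%:R); first by near: n; exact: nbhs_infty_ger.
  by rewrite /v2 -addn1 natrD; lra.
have cF := is_cderive_continuous (Fderive s0).
have -> : cintegral mu A f = F s - 0.
  apply: (cintegral_FTC_exhaustion (F := F) (u := u1) (v := fun=> s)) => //.
  - by move=> x; rewrite /A /= in_itv/= => /andP[x0 _]; exact: Fderive.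
  - by move=> x; rewrite /A /= in_itv/= => /andP[x0 _]; exact: fderive.
  - move=> n; rewrite /u1 ltr_pdivrMr// ltr_pdivrMr// -mulrA ltr_pMr//.
    by rewrite -natrM ltr1n.
  - move=> n x /andP[ux xs]; rewrite /A /= in_itv/= xs andbT.
    exact: lt_le_trans ux.
  - move=> x; rewrite /A /= in_itv/= => /andP[x0 xs].
    by near=> n; rewrite xs andbT; near: n; exact: (cvgr_le 0).
  - by apply: F_cvg0 => //; exact: h_cvg_at0.
  - by split; exact: cvg_cst.
have -> : cintegral mu B (fun x => (1 - kappa) * f x) = 0 - (1 - kappa) * F s.
  rewrite -(mulr0 (1 - kappa)).
  apply: (cintegral_FTC_exhaustion (F := fun x => (1 - kappa) * F x)
    (u := u2) (v := v2)) => //.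
  - move=> x; rewrite /B /= in_itv/= andbT => sx.
    by apply: is_cderiveZ; apply: Fderive; exact: lt_trans sx.
  - move=> x; rewrite /B /= in_itv/= andbT => sx.
    have [df fdf] := fderive (lt_trans s0 sx).
    by eexists; apply: is_cderiveZ; exact: fdf.
  - move=> n; rewrite /u2 /v2 -addrA ltrD2l.
    by rewrite (@le_lt_trans _ _ 1)// ?invf_le1// ?ler1n// ltrDl.
  - move=> n x /andP[ux _]; rewrite /B /= in_itv/= andbT.
    exact: lt_le_trans ux.
  - move=> x; rewrite /B /= in_itv/= andbT => sx.
    near=> n; apply/andP; split; near: n; first exact: (cvgr_le s).
    by move/cvgryPge : v2_cvg; exact.
  - apply: (ccvgZ (1 - kappa)); split.
      exact: (cvg_comp _ _ u2_cvg cF.1).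
    exact: (cvg_comp _ _ u2_cvg cF.2).
  - apply: (ccvgZ (1 - kappa)); apply: F_cvg0.
      by move=> n; rewrite /v2 !addr_gt0.
    by apply: h_cvg_aty => // n; rewrite /v2 !addr_gt0.
(* The two pieces leave F s - (1 - kappa) F s = kappa F s, which is the jump term. *)
rewrite /F /g /jump rmorphM /=; ring.
Unshelve. all: by end_near. Qed.

End WeightByParts.

(** * The Cauchy pairing on monomials *)

Section ComplexFubini2.
Context {R : realType}.
Local Notation mu := (@lebesgue_measure R).
Local Notation TR := (measurableTypeR R).
Let mh := @measurable_halfline R.
Let mq := @measurable_quadrant R.

Lemma cfubini (F : R * R -> R[i]) :
  cintegrable (mu \x mu)%E quadrant F ->
  (forall x, 0 < x -> cintegrable mu halfline (fun y => F (x, y))) ->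
  cintegrable mu halfline (fun x => cintegral mu halfline (fun y => F (x, y))) /\
  cintegral (mu \x mu)%E quadrant F =
  cintegral mu halfline (fun x => cintegral mu halfline (fun y => F (x, y))).
Proof.
move=> [F1 F2] Fs.
have s1 x x0 := (Fs x x0).1.
have s2 x x0 := (Fs x x0).2.
split; first by split; [exact: (integrable_quadrant1 F1 s1)|
                        exact: (integrable_quadrant1 F2 s2)].
rewrite /cintegral; congr (_ +i* _).
- exact: (Rintegral_quadrant F1 s1).
- exact: (Rintegral_quadrant F2 s2).
Qed.

Lemma cintegrable_swap (F : R * R -> R[i]) :
  cintegrable (mu \x mu)%E quadrant F ->
  cintegrable (mu \x mu)%E quadrant (fun u => F (u.2, u.1)).
Proof.
move=> [F1 F2]; split.
  exact: (integrable_quadrant_swap F1).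
exact: (integrable_quadrant_swap F2).
Qed.

Lemma cintegral_swap (F : R * R -> R[i]) :
  cintegrable (mu \x mu)%E quadrant F ->
  cintegral (mu \x mu)%E quadrant (fun u => F (u.2, u.1)) =
  cintegral (mu \x mu)%E quadrant F.
Proof.
move=> [F1 F2]; rewrite /cintegral; congr (_ +i* _).
- exact: (Rintegral_quadrant_swap F1).
- exact: (Rintegral_quadrant_swap F2).
Qed.

Lemma measurable_frac_quadrant :
  @measurable_fun _ _ (TR * TR)%type R quadrant (fun u => u.2 / (u.1 + u.2)).
Proof.
apply: measurable_funM; first exact: measurable_funS measurable_snd.
apply: measurable_fun_invr.
  by move=> u [u1 u2]; rewrite ltW// addr_gt0.
apply: measurable_funD.
  exact: measurable_funS measurable_fst.
exact: measurable_funS measurable_snd.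
Qed.

Lemma bounded_frac_quadrant :
  [bounded u.2 / (u.1 + u.2) : R | u in @quadrant R].
Proof.
apply: (@bounded_on _ _ _ _ 1) => u [u1 u2].
have u0 : 0 < u.1 + u.2 by rewrite addr_gt0.
rewrite ger0_norm ?divr_ge0 ?(ltW u2) ?(ltW u0)//.
by rewrite ler_pdivrMr// mul1r lerDr ltW.
Qed.

End ComplexFubini2.

(** The interval (0, s) has measure s > 0, so it cannot lie inside the null set where [P] may
    fail. *)
Lemma ae_exists_itv {R : realType} (P : R -> Prop) (s : R) : 0 < s ->
  {ae (@lebesgue_measure R), forall x, P x} -> exists x, 0 < x < s /\ P x.
Proof.
move=> s0 [A [mA A0 PA]]; apply: contrapT => noP.
have sub : `]0, s[%classic `<=` A.
  move=> x /= /[!in_itv] /= xs; apply: PA => /= Px.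
  by apply: noP; exists x.
pose I := `]0, s[%classic : set R.
have : (lebesgue_measure I <= lebesgue_measure A)%E.
  by apply: le_measure => //; rewrite inE//; exact: measurable_itv.
rewrite [X in (_ <= X)%E]A0 /I lebesgue_measure_itv /= lte_fin s0.
by rewrite oppr0 addr0 lee_fin leNgt s0.
Qed.

Section CauchyPairing.
Context {R : realType}.
Local Notation mu := (@lebesgue_measure R).
Variables w1 w2 : R -> R[i].
Hypothesis w12 : forall j k, moment_integrable w1 w2 j k.
Let mh := @measurable_halfline R.
Let mq := @measurable_quadrant R.

Lemma pairing_integrandXX (j k : nat) (u : R * R) :
  pairing_integrand w1 w2 'X^j 'X^k u =
  w1 u.1 * w2 u.2 * (u.1 ^+ j * u.2 ^+ k / (u.1 + u.2))%:C.
Proof.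
rewrite /pairing_integrand !hornerXn !(rmorphM, rmorphXn, fmorphV) /=.
by ring.
Qed.

Lemma cintegrable_cauchy (j k : nat) :
  cintegrable (mu \x mu)%E quadrant
    (fun u => w1 u.1 * w2 u.2 * (u.1 ^+ j * u.2 ^+ k / (u.1 + u.2))%:C).
Proof.
apply: (eq_cintegrable mq) (w12 j k) => u _; exact: pairing_integrandXX.
Qed.

Lemma pairingXX (j k : nat) : pairing w1 w2 'X^j 'X^k =
  cintegral (mu \x mu)%E quadrant
    (fun u => w1 u.1 * w2 u.2 * (u.1 ^+ j * u.2 ^+ k / (u.1 + u.2))%:C).
Proof. by apply: eq_cintegral => u _; exact: pairing_integrandXX. Qed.

(** Two Cauchy moments add up to the product moment, because x^j y^k = (x^(j+1) y^k + x^j y^(k+1)) /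
    (x + y). The factorisation in [pairing_addXX] rests on the same identity. *)
Lemma cintegrable_cauchy_prod (j k : nat) :
  cintegrable (mu \x mu)%E quadrant
    (fun u => w1 u.1 * w2 u.2 * (u.1 ^+ j * u.2 ^+ k)%:C).
Proof.
have := cintegrableD mq (cintegrable_cauchy j.+1 k) (cintegrable_cauchy j k.+1).
apply: (eq_cintegrable mq) => u [u1 u2].
rewrite -mulrDr -rmorphD; congr (_ * _%:C).
by rewrite !exprS; field; rewrite gt_eqF// addr_gt0.
Qed.

Lemma cintegrable_cauchy2 (j k : nat) :
  cintegrable (mu \x mu)%E quadrant
    (fun u => w1 u.1 * w2 u.2 * (u.1 ^+ j * u.2 ^+ k.+1 / (u.1 + u.2) ^+ 2)%:C).
Proof.
have := cintegrableMr mq measurable_frac_quadrant bounded_frac_quadrant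
  (cintegrable_cauchy j k).
apply: (eq_cintegrable mq) => u [u1 u2].
rewrite -mulrA -rmorphM; congr (_ * _%:C).
by rewrite !exprS; field; rewrite gt_eqF// addr_gt0.
Qed.

(* Take one slice [x] on which [w2 y * y ^ k / (x + y)] is integrable and use
   [y ^ k = x * y ^ k / (x + y) + y ^ k.+1 / (x + y)]. *)
Lemma finite_moments_right (s : R) : 0 < s ->
  (forall x, 0 < x < s -> w1 x != 0) ->
  forall k, cintegrable mu halfline (fun y => w2 y * (y ^+ k)%:C).
Proof.
move=> s0 w1n0 k.
have slice m : {ae mu, forall x, 0 < x -> cintegrable mu halfline
    (fun y => w1 x * w2 y * (x ^+ 0 * y ^+ m / (x + y))%:C)}.
  have [i1 i2] := cintegrable_cauchy 0 m.
  have := ae_integrable_quadrant i1; have := ae_integrable_quadrant i2.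
  apply: (filterS2 (ae_filter_ringOfSetsType mu)) => x h2 h1 x0.
  by split; [exact: h1|exact: h2].
have [x [xs [sk sk1]]] := ae_exists_itv s0
  (@filterI _ _ (ae_filter_ringOfSetsType mu) _ _ (slice k) (slice k.+1)).
have /andP[x0 _] := xs; have i1 := sk x0; have i2 := sk1 x0.
have w1x := w1n0 _ xs.
have := cintegrableD mh (cintegrableZ mh ((w1 x)^-1 * x%:C) i1)
  (cintegrableZ mh (w1 x)^-1 i2).
apply: (eq_cintegrable mh) => y y0.
have xy : (x + y)%:C != 0 :> R[i].
  by rewrite -[0]/(0%:C) (inj_eq (@complexI R)) gt_eqF// addr_gt0.
rewrite !(rmorphM, rmorphXn, fmorphV) /= expr0 exprS.
rewrite rmorphD /= in xy *; field.
by rewrite w1x xy.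
Qed.

End CauchyPairing.

Section CauchyPairing2.
Context {R : realType}.
Local Notation mu := (@lebesgue_measure R).
Let mh := @measurable_halfline R.
Let mq := @measurable_quadrant R.

Section Generic.
Variables w1 w2 : R -> R[i].
Hypothesis w12 : forall j k, moment_integrable w1 w2 j k.
Hypothesis w1fin : forall k, cintegrable mu halfline (fun x => w1 x * (x ^+ k)%:C).
Hypothesis w2fin : forall k, cintegrable mu halfline (fun x => w2 x * (x ^+ k)%:C).

Lemma wintXn (w : R -> R[i]) (k : nat) :
  wint w 'X^k = cintegral mu halfline (fun x => w x * (x ^+ k)%:C).
Proof.
by apply: eq_cintegral => x _; rewrite hornerXn rmorphXn.
Qed.

(** The kernel is left general because it is needed for y^k / (y + x), for y^k and for y^(k+1) / (y
    + x)^2. *)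
Lemma cfubini_kernel (j : nat) (K : R -> R -> R) :
  cintegrable (mu \x mu)%E quadrant
    (fun u => w1 u.1 * w2 u.2 * (u.1 ^+ j * K u.1 u.2)%:C) ->
  (forall x, 0 < x -> cintegrable mu halfline (fun y => w2 y * (K x y)%:C)) ->
  cintegrable mu halfline (fun x => w1 x * (x ^+ j)%:C *
    cintegral mu halfline (fun y => w2 y * (K x y)%:C)) /\
  cintegral (mu \x mu)%E quadrant
    (fun u => w1 u.1 * w2 u.2 * (u.1 ^+ j * K u.1 u.2)%:C) =
  cintegral mu halfline (fun x => w1 x * (x ^+ j)%:C *
    cintegral mu halfline (fun y => w2 y * (K x y)%:C)).
Proof.
move=> Ki Ks.
have slice x y : w1 x * w2 y * (x ^+ j * K x y)%:C =
    w1 x * (x ^+ j)%:C * (w2 y * (K x y)%:C) by rewrite rmorphM /=; ring.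
have innerE x : 0 < x ->
    cintegral mu halfline (fun y => w1 x * w2 y * (x ^+ j * K x y)%:C) =
    w1 x * (x ^+ j)%:C * cintegral mu halfline (fun y => w2 y * (K x y)%:C).
  move=> x0; rewrite -(cintegralZ mh _ (Ks x x0)).
  by apply: eq_cintegral => y _; exact: slice.
have [|i1 i2] := cfubini Ki.
  move=> x x0; apply: (eq_cintegrable mh) (cintegrableZ mh _ (Ks x x0)) => y _.
  by rewrite /= slice.
split; first exact: (eq_cintegrable mh innerE i1).
by rewrite i2; exact: eq_cintegral.
Qed.

Lemma pairing_stieltjes (j k : nat) :
  cintegrable mu halfline (fun x => w1 x * (x ^+ j)%:C *
    cintegral mu halfline (fun y => w2 y * (y ^+ k / (y + x))%:C)) /\
  pairing w1 w2 'X^j 'X^k =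
  cintegral mu halfline (fun x => w1 x * (x ^+ j)%:C *
    cintegral mu halfline (fun y => w2 y * (y ^+ k / (y + x))%:C)).
Proof.
have KE (u : R * R) : quadrant u ->
    w1 u.1 * w2 u.2 * (u.1 ^+ j * u.2 ^+ k / (u.1 + u.2))%:C =
    w1 u.1 * w2 u.2 * (u.1 ^+ j * (u.2 ^+ k / (u.2 + u.1)))%:C.
  by move=> _; rewrite mulrA [u.1 + _]addrC.
rewrite (pairingXX w1 w2) (eq_cintegral (mu \x mu)%E KE).
apply: (@cfubini_kernel j (fun x y => y ^+ k / (y + x))).
  exact: (eq_cintegrable mq KE (cintegrable_cauchy w12 j k)).
move=> x x0; apply: (eq_cintegrable mh) (cintegrable_kernel w2fin k 1 x0) => y _.
by rewrite expr1.
Qed.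

Lemma pairing_addXX (j k : nat) :
  pairing w1 w2 'X^(j.+1) 'X^k + pairing w1 w2 'X^j 'X^(k.+1) =
  wint w1 'X^j * wint w2 'X^k.
Proof.
rewrite !(pairingXX w1 w2) -(cintegralD mq); try exact: cintegrable_cauchy.
have KE (u : R * R) : quadrant u ->
    w1 u.1 * w2 u.2 * (u.1 ^+ j.+1 * u.2 ^+ k / (u.1 + u.2))%:C +
    w1 u.1 * w2 u.2 * (u.1 ^+ j * u.2 ^+ k.+1 / (u.1 + u.2))%:C =
    w1 u.1 * w2 u.2 * (u.1 ^+ j * u.2 ^+ k)%:C.
  move=> [u1 u2]; rewrite -mulrDr -rmorphD; congr (_ * _%:C).
  by rewrite !exprS; field; rewrite gt_eqF// addr_gt0.
rewrite (eq_cintegral (mu \x mu)%E KE).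
have [|_ ->] := @cfubini_kernel j (fun x y => y ^+ k) (cintegrable_cauchy_prod w12 j k).
  by move=> x _; exact: w2fin.
rewrite !wintXn mulrC -(cintegralZ mh _ (w1fin j)).
by apply: eq_cintegral => x _; rewrite mulrC.
Qed.

(* [k] stands for the factor [y ^ k.+1]: the extra [y] keeps [y / (x + y)] bounded. *)
Definition pairing2 (w1 w2 : R -> R[i]) (j k : nat) : R[i] :=
  cintegral (mu \x mu)%E quadrant (fun u =>
    w1 u.1 * w2 u.2 * (u.1 ^+ j * u.2 ^+ k.+1 / (u.1 + u.2) ^+ 2)%:C).

End Generic.

Section Swap.
Variables w1 w2 : R -> R[i].
Hypothesis w12 : forall j k, moment_integrable w1 w2 j k.

Lemma moment_integrable_swap (j k : nat) : moment_integrable w2 w1 j k.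
Proof.
apply: (eq_cintegrable mq) (cintegrable_swap (w12 k j)) => u _ /=.
by rewrite /pairing_integrand /= [u.2 + u.1]addrC; ring.
Qed.

Lemma pairing_swapXX (j k : nat) :
  pairing w1 w2 'X^j 'X^k = pairing w2 w1 'X^k 'X^j.
Proof.
rewrite /pairing -(cintegral_swap (w12 j k)); apply: eq_cintegral => u _.
by rewrite /pairing_integrand /= [u.2 + u.1]addrC; ring.
Qed.

(** After exchanging the variables, the second term carries x^(j+1) where the first carries y^(k+1),
    so the two numerators supply a factor x + y. This removes the kernel 1/(x + y)^2 once the
    integrations by parts in x and in y are added. *)
Lemma pairing2_addXX (j k : nat) :
  pairing2 w1 w2 j k + pairing2 w2 w1 k j = pairing w1 w2 'X^j 'X^k.
Proof.
rewrite /pairing2 -(cintegral_swap (cintegrable_cauchy2 moment_integrable_swap k j)).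
rewrite -(cintegralD mq); first last.
- exact: cintegrable_swap (cintegrable_cauchy2 moment_integrable_swap k j).
- exact: cintegrable_cauchy2.
rewrite (pairingXX w1 w2); apply: eq_cintegral => u [u1 u2] /=.
rewrite [w2 _ * w1 _]mulrC -mulrDr -rmorphD; congr (_ * _%:C).
rewrite [u.2 + u.1]addrC !exprS; field.
by rewrite gt_eqF// addr_gt0.
Qed.

End Swap.

Section Right.
Variables (w1 : R -> R[i]) (c kappa : R[i]) (t : R).
Local Notation w2 := (weight c kappa t).
Hypotheses (hc : -1 < complex.Re c) (t0 : 0 < t).
Hypothesis w12 : forall j k, moment_integrable w1 w2 j k.
Hypothesis w1fin : forall k, cintegrable mu halfline (fun x => w1 x * (x ^+ k)%:C).
Hypothesis w2fin : forall k, cintegrable mu halfline (fun x => w2 x * (x ^+ k)%:C).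

(** [weight_by_parts] in y for fixed x, integrated against w1(x) x^j. The version in x follows by
    applying it to the exchanged weights. *)
Lemma pairing_by_parts_right (j k : nat) :
  (c + 1 + k%:R) * pairing w1 w2 'X^j 'X^k - pairing w1 w2 'X^j 'X^(k.+1)
    - pairing2 w1 w2 j k =
  jump c kappa t * (t ^+ k)%:C *
    cintegral mu halfline (fun x => w1 x * (x ^+ j / (x + t))%:C).
Proof.
pose I m l x := cintegral mu halfline (fun y => w2 y * (y ^+ m / (y + x) ^+ l)%:C).
have frI m l x : 0 < x ->
    cintegrable mu halfline (fun y => w2 y * (y ^+ m / (y + x) ^+ l)%:C).
  by move=> x0; exact: cintegrable_kernel.
have I1 m x : cintegral mu halfline (fun y => w2 y * (y ^+ m / (y + x))%:C) = I m 1%N x.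
  by apply: eq_cintegral => y _; rewrite expr1.
have [p1 ->] := pairing_stieltjes w12 w2fin j k.
have [p2 ->] := pairing_stieltjes w12 w2fin j k.+1.
have [p3 p3E] : cintegrable mu halfline (fun x => w1 x * (x ^+ j)%:C * I k.+1 2 x) /\
    pairing2 w1 w2 j k = cintegral mu halfline (fun x => w1 x * (x ^+ j)%:C * I k.+1 2 x).
  have KE (u : R * R) : quadrant u ->
      w1 u.1 * w2 u.2 * (u.1 ^+ j * u.2 ^+ k.+1 / (u.1 + u.2) ^+ 2)%:C =
      w1 u.1 * w2 u.2 * (u.1 ^+ j * (u.2 ^+ k.+1 / (u.2 + u.1) ^+ 2))%:C.
    by move=> _; rewrite mulrA [u.1 + _]addrC.
  rewrite /pairing2 (eq_cintegral (mu \x mu)%E KE).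
  apply: (@cfubini_kernel w1 w2 j (fun x y => y ^+ k.+1 / (y + x) ^+ 2)).
    exact: (eq_cintegrable mq KE (cintegrable_cauchy2 w12 j k)).
  by move=> x x0; exact: frI.
rewrite p3E -(cintegral_lincomb mh _ p1 p2 p3).
have r1 := cintegrable_kernel w1fin j 1 t0.
under [in RHS]eq_fun do rewrite -[_ + t]expr1.
rewrite -(cintegralZ mh _ r1).
apply: eq_cintegral => x x0.
rewrite !I1 expr1.
have := weight_by_parts (kappa := kappa) k hc x0 t0 w2fin.
have -> : cintegral mu halfline (fun y => w2 y *
    ((c + 1 + k%:R) * (y ^+ k / (y + x))%:C - (y ^+ k.+1 / (y + x))%:C
      - (y ^+ k.+1 / (y + x) ^+ 2)%:C)) =
    (c + 1 + k%:R) * I k 1%N x - I k.+1 1%N x - I k.+1 2 x.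
  rewrite /I -(cintegral_lincomb mh _ (frI k 1%N x x0) (frI k.+1 1%N x x0)
    (frI k.+1 2 x x0)).
  by apply: eq_cintegral => y _; rewrite expr1; ring.
move=> E.
have -> : (x ^+ j / (x + t))%:C = (x ^+ j)%:C / (x + t)%:C.
  by rewrite rmorphM fmorphV.
rewrite [x + t]addrC.
have E' : (t ^+ k)%:C / (t + x)%:C = (t ^+ k / (t + x))%:C.
  by rewrite rmorphM fmorphV.
have -> : jump c kappa t * (t ^+ k)%:C * (w1 x * ((x ^+ j)%:C / (t + x)%:C)) =
  w1 x * (x ^+ j)%:C * (jump c kappa t * ((t ^+ k)%:C / (t + x)%:C)) by ring.
by rewrite E' -E; ring.
Qed.

End Right.
End CauchyPairing2.

(** * Derivative of the pairing with respect to the position of a jump *)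

Section JumpDerivative.
Context {R : realType}.
Local Notation mu := (@lebesgue_measure R).
Let mh := @measurable_halfline R.

Lemma is_cderive_primitive (f : R -> R[i]) (s u : R) : 0 < s -> s < u ->
  cintegrable mu `]0, u] f -> (exists df, is_cderive f s df) ->
  is_cderive (fun x => cintegral mu `]0, x] f) s (f s).
Proof.
move=> s0 su [f1 f2] [df /is_cderive_continuous[c1 c2]].
have s0' : (BRight 0 < BRight s)%O by rewrite bnd_simp.
have [d1 v1] := continuous_FTC1 su f1 s0' c1.
have [d2 v2] := continuous_FTC1 su f2 s0' c2.
rewrite derive1E in v1; rewrite derive1E in v2.
by split; [exact: (DeriveDef d1 v1)|exact: (DeriveDef d2 v2)].
Qed.

Variables (c kappa : R[i]).

(** Fix some u > s. For s' < u the integral equals kappa times the integral of [f] over (0, s'] plus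
    a constant [K], so its derivative is that of a primitive. Beyond u the factor 1 - kappa stays
    attached to [f], because only the product is known to be integrable there. *)
Lemma is_cderive_jump (f : R -> R[i]) (s : R) : 0 < s ->
  (exists df, is_cderive f s df) ->
  (\forall s' \near s, cintegrable mu halfline
     (fun x => (1 - kappa * (s' < x)%R%:R) * f x)) ->
  is_cderive (fun s' => cintegral mu halfline
     (fun x => (1 - kappa * (s' < x)%R%:R) * f x)) s (kappa * f s).
Proof.
move=> s0 df fnear.
(* With the jump placed at [u], the step factor is 1 on (0, u], which gives integrability of [f]
   itself there. *)
have [u su fu] : exists2 u, s < u & cintegrable mu halfline
     (fun x => (1 - kappa * (u < x)%R%:R) * f x).
  near s^'+ => u; exists u; near: u; first exact: nbhs_right_gt.
  by apply: cvg_within; exact: fnear.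
have mi (i : interval R) : @measurable _ (measurableTypeR R) [set` i].
  exact: measurable_itv.
have hU (v : R) : 0 < v -> @halfline R = `]0, v] `|` `]v, +oo[.
  move=> v0; apply/seteqP; split => x; rewrite /halfline /= !in_itv /= andbT.
    by move=> x0; case: (leP x v) => xs; [left; rewrite x0|right].
  by case=> [/andP[]//|]; exact: lt_trans.
have dU (v : R) : [disjoint `]0, v]%classic & `]v, +oo[%classic].
  by apply/disj_setPS => x; rewrite /= !in_itv/= andbT => -[/andP[_ /le_gtF ->]].
have u0 := lt_trans s0 su.
have fi : cintegrable mu `]0, u] f.
  have : cintegrable mu `]0, u] (fun x => (1 - kappa * (u < x)%R%:R) * f x).
    by apply: (cintegrableS mh) fu => //; rewrite (hU u u0); exact: subsetUl.
  apply: (eq_cintegrable (mi _)) => x /=; rewrite in_itv/= => /andP[_ xu].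
  by rewrite ltNge xu mulr0 subr0 mul1r.
pose K := (1 - kappa) * cintegral mu `]0, u] f +
  cintegral mu `]u, +oo[ (fun x => (1 - kappa) * f x).
have dp := is_cderive_primitive s0 su fi df.
have := is_cderiveD (is_cderive_cst K s) (is_cderiveZ kappa dp).
rewrite add0r; apply: is_cderive_near.
near=> s'.
have s'0 : 0 < s' by near: s'; exact: lt_nbhsr.
have s'u : s' < u by near: s'; exact: lt_nbhsl.
have fs' : cintegrable mu halfline (fun x => (1 - kappa * (s' < x)%R%:R) * f x).
  by near: s'.
rewrite [in RHS](hU u u0); rewrite (hU u u0) in fs'.
rewrite (cintegral_setU (mi _) (mi _) (dU u) fs').
have sub : `]0, u]%classic = `]0, s'] `|` `]s', u] :> set R.
  apply/seteqP; split => x; rewrite /= !in_itv /=.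
    by move=> /andP[x0 xu]; case: (leP x s') => xs; [left; rewrite x0|right].
  case=> /andP[x0 xs]; first by rewrite x0 (le_trans xs)// ltW.
  by rewrite xs andbT (lt_trans _ x0).
have dsub : [disjoint `]0, s']%classic & `]s', u]%classic].
  by apply/disj_setPS => x; rewrite /= !in_itv/= => -[/andP[_ /le_gtF ->]].
have fs'u := cintegrableS (measurableU _ _ (mi _) (mi _)) (mi _) (@subsetUl _ _ _) fs'.
rewrite [in RHS]sub; rewrite sub in fs'u.
rewrite (cintegral_setU (mi _) (mi _) dsub fs'u).
have fi' := fi; rewrite sub in fi'.
have fi2 := cintegrableS (measurableU _ _ (mi _) (mi _)) (mi _) (@subsetUr _ _ _) fi'.
rewrite /K sub (cintegral_setU (mi _) (mi _) dsub fi').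
have -> : cintegral mu `]0, s'] (fun x => (1 - kappa * (s' < x)%R%:R) * f x) =
    cintegral mu `]0, s'] f.
  apply: eq_cintegral => x /=; rewrite in_itv/= => /andP[_ xs].
  by rewrite ltNge xs mulr0 subr0 mul1r.
have -> : cintegral mu `]s', u] (fun x => (1 - kappa * (s' < x)%R%:R) * f x) =
    (1 - kappa) * cintegral mu `]s', u] f.
  rewrite -(cintegralZ (mi _) _ fi2).
  apply: eq_cintegral => x /=; rewrite in_itv/= => /andP[xs _].
  by rewrite xs mulr1.
have -> : cintegral mu `]u, +oo[ (fun x => (1 - kappa * (s' < x)%R%:R) * f x) =
    cintegral mu `]u, +oo[ (fun x => (1 - kappa) * f x).
  apply: eq_cintegral => x /=; rewrite in_itv/= andbT => ux.
  by rewrite (lt_trans s'u ux) mulr1.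
by ring.
Unshelve. all: by end_near. Qed.

(** By Fubini the pairing is a one-dimensional integral in x whose integrand depends on s' only
    through the step. The remaining factor contains the Stieltjes transform of w2, which is
    differentiable, so [is_cderive_jump] applies. *)
Lemma is_cderive_pairing (w2 : R -> R[i]) (s : R) (j k : nat) : 0 < s ->
  (forall k, cintegrable mu halfline (fun x => w2 x * (x ^+ k)%:C)) ->
  (\forall s' \near s, forall j k, moment_integrable (weight c kappa s') w2 j k) ->
  is_cderive (fun s' => pairing (weight c kappa s') w2 'X^j 'X^k) s
    (kappa * cpow s c * (expR (- s))%:C * (s ^+ j)%:C *
     cintegral mu halfline (fun y => w2 y * (y ^+ k / (y + s))%:C)).
Proof.
move=> s0 w2fin Mnear.
pose f x := cpow x c * (expR (- x))%:C * (x ^+ j)%:C *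
  cintegral mu halfline (fun y => w2 y * (y ^+ k / (y + x))%:C).
have df : exists df, is_cderive f s df.
  have dE : is_derive s 1 (fun z : R => expR (- z)) (- expR (- s)).
    by apply: is_derive_eq; rewrite /GRing.scale /=; ring.
  have dX : is_derive s 1 (fun z : R => z ^+ j) (j%:R * s ^+ j.-1).
    have -> : (fun z : R => z ^+ j) = id ^+ j.
      by apply/funext => z; rewrite exprfctE.
    by apply: is_derive_eq; rewrite /GRing.scale /= mulr1.
  eexists; rewrite /f.
  apply: is_cderiveM; last exact: is_cderive_stieltjes.
  apply: is_cderiveM; last exact: is_cderive_real dX.
  exact: is_cderiveM (is_cderive_cpow c s0) (is_cderive_real dE).
have wE s' x : weight c kappa s' x * (x ^+ j)%:C *
    cintegral mu halfline (fun y => w2 y * (y ^+ k / (y + x))%:C) =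
    (1 - kappa * (s' < x)%R%:R) * f x by rewrite /f /weight; ring.
have fnear : \forall s' \near s, cintegrable mu halfline
     (fun x => (1 - kappa * (s' < x)%R%:R) * f x).
  near=> s'; have Ms' : forall j k, moment_integrable (weight c kappa s') w2 j k.
    by near: s'.
  have [+ _] := pairing_stieltjes Ms' w2fin j k.
  by apply: (eq_cintegrable mh) => x _; exact: wE.
have := is_cderive_jump s0 df fnear.
have -> : kappa * f s = kappa * cpow s c * (expR (- s))%:C * (s ^+ j)%:C *
   cintegral mu halfline (fun y => w2 y * (y ^+ k / (y + s))%:C).
  by rewrite /f; ring.
apply: is_cderive_near; near=> s'.
have Ms' : forall j k, moment_integrable (weight c kappa s') w2 j k by near: s'.
have [_ ->] := pairing_stieltjes Ms' w2fin j k.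
by apply: eq_cintegral => x _; rewrite wE.
Unshelve. all: by end_near. Qed.

End JumpDerivative.

(** * Functionals of polynomials *)

Section ScalarFunctionals.
Context {K : fieldType}.
Implicit Types (L : {poly K} -> K) (p q : {poly K}).

Lemma functional0 L : scalar L -> L 0 = 0.
Proof.
move=> LL; have := LL 1 0 0; rewrite scaler0 addr0 mul1r => /esym.
by move/(canRL (addrK _)); rewrite subrr.
Qed.

Lemma functionalD L p q : scalar L -> L (p + q) = L p + L q.
Proof. by move=> LL; rewrite -[p]scale1r LL mul1r scale1r. Qed.

Lemma functionalZ L (c : K) p : scalar L -> L (c *: p) = c * L p.
Proof. by move=> LL; rewrite -[c *: p]addr0 LL (functional0 LL) addr0. Qed.

Lemma functionalN L p : scalar L -> L (- p) = - L p.
Proof. by move=> LL; rewrite -scaleN1r functionalZ// mulN1r. Qed.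

Lemma functionalB L p q : scalar L -> L (p - q) = L p - L q.
Proof. by move=> LL; rewrite functionalD// functionalN. Qed.

Lemma functional_sum L (I : Type) (r : seq I) (F : I -> {poly K}) : scalar L ->
  L (\sum_(i <- r) F i) = \sum_(i <- r) L (F i).
Proof.
move=> LL; elim: r => [|i r ih]; first by rewrite !big_nil functional0.
by rewrite !big_cons functionalD// ih.
Qed.

Lemma poly_sumXn p (N : nat) : (size p <= N)%N -> p = \sum_(i < N) p`_i *: 'X^i.
Proof.
move=> pN; rewrite -poly_def; apply/polyP => i; rewrite coef_poly.
by case: ltnP => // Ni; have /leq_sizeP -> := pN.
Qed.

Lemma scalar_coefE L p (N : nat) : scalar L -> (size p <= N)%N ->
  L p = \sum_(i < N) p`_i * L 'X^i.
Proof.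
move=> LL pN; rewrite {1}(poly_sumXn pN) functional_sum//.
by apply: eq_bigr => i _; rewrite functionalZ.
Qed.

Lemma scalar_ext L1 L2 : scalar L1 -> scalar L2 ->
  (forall i, L1 'X^i = L2 'X^i) -> L1 =1 L2.
Proof.
move=> l1 l2 L12 p; rewrite (scalar_coefE l1 (leqnn _)).
by rewrite (scalar_coefE l2 (leqnn _)); apply: eq_bigr => i _; rewrite L12.
Qed.

(** This carries the identities between integrals from monomials to all polynomials. *)
Lemma bilinear_ext (F G : {poly K} -> {poly K} -> K) :
  (forall q, scalar (fun p => F p q)) -> (forall p, scalar (F p)) ->
  (forall q, scalar (fun p => G p q)) -> (forall p, scalar (G p)) ->
  (forall j k, F 'X^j 'X^k = G 'X^j 'X^k) -> forall p q, F p q = G p q.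
Proof.
move=> Fl Fr Gl Gr FG p q; apply: (scalar_ext (Fr p) (Gr p)) => k.
by move: p; apply: (scalar_ext (Fl _) (Gl _)) => j.
Qed.

Lemma scalar_horner (x : K) : scalar (fun p => p.[x]).
Proof. by move=> c p q; rewrite hornerD hornerZ. Qed.

Lemma scalar_mulX L : scalar L -> scalar (fun p => L ('X * p)).
Proof. by move=> LL c p q; rewrite mulrDr -scalerAr LL. Qed.

Lemma scalar_mulXderiv L : scalar L -> scalar (fun p => L ('X * p^`())).
Proof. by move=> LL c p q; rewrite derivD derivZ mulrDr -scalerAr LL. Qed.

Lemma scalar_add L1 L2 : scalar L1 -> scalar L2 -> scalar (fun p => L1 p + L2 p).
Proof. by move=> l1 l2 c p q; rewrite l1 l2; ring. Qed.

Lemma scalar_mull (k : K) L : scalar L -> scalar (fun p => k * L p).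
Proof. by move=> LL c p q; rewrite LL; ring. Qed.

Lemma scalar_mulr (k : K) L : scalar L -> scalar (fun p => L p * k).
Proof. by move=> LL c p q; rewrite LL; ring. Qed.

Lemma scalar_opp L : scalar L -> scalar (fun p => - L p).
Proof. by move=> LL c p q; rewrite LL; ring. Qed.

Lemma mulX_derivXn (k : nat) : 'X * ('X^k)^`() = k%:R *: 'X^k :> {poly K}.
Proof.
rewrite derivXn; case: k => [|k]; first by rewrite mulr0n mulr0 scale0r.
by rewrite /= mulrnAr -exprS scaler_nat.
Qed.

Lemma size_mulXderiv p (n : nat) : (size p <= n)%N -> (size ('X * p^`())%R <= n)%N.
Proof.
move=> pn; apply/leq_sizeP => -[|j] nj; rewrite coefXM//= coef_deriv.
by have /leq_sizeP -> := pn; rewrite ?mul0rn.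
Qed.

End ScalarFunctionals.

(** * Polynomials and linear functionals that vary with a parameter *)

Section MovingPolynomials.
Context {R : realType}.
Implicit Types (p q dP dQ : {poly R[i]}) (s : R) (P Q : R -> {poly R[i]})
  (L : R -> {poly R[i]} -> R[i]).

(* The degree bound makes every linear functional of [P s'] a fixed finite sum. *)
Definition is_pderive (N : nat) P (s : R) (dP : {poly R[i]}) : Prop :=
  [/\ (size dP <= N)%N, \forall s' \near s, (size (P s') <= N)%N &
      forall i, is_cderive (fun s' => (P s')`_i) s dP`_i].

Lemma is_pderive_cst N p s : (size p <= N)%N -> is_pderive N (fun=> p) s 0.
Proof.
move=> pN; split; first by rewrite size_poly0.
  by near=> s'.
by move=> i; rewrite coef0; exact: is_cderive_cst.
Unshelve. all: by end_near. Qed.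

Lemma is_pderiveD N P Q s dP dQ : is_pderive N P s dP -> is_pderive N Q s dQ ->
  is_pderive N (fun s' => P s' + Q s') s (dP + dQ).
Proof.
move=> [dPN PN Pd] [dQN QN Qd]; split.
- by rewrite (leq_trans (size_polyD _ _))// geq_max dPN dQN.
- near=> s'; rewrite (leq_trans (size_polyD _ _))// geq_max.
  by apply/andP; split; near: s'.
- move=> i; rewrite coefD; under eq_fun do rewrite coefD.
  exact: is_cderiveD.
Unshelve. all: by end_near. Qed.

Lemma is_pderiveZ N (c : R -> R[i]) P s dc dP : is_cderive c s dc ->
  is_pderive N P s dP ->
  is_pderive N (fun s' => c s' *: P s') s (dc *: P s + c s *: dP).
Proof.
move=> cd [dPN PN Pd]; split.
- rewrite (leq_trans (size_polyD _ _))// geq_max.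
  rewrite (leq_trans (size_scale_leq _ _))//; last exact: nbhs_singleton PN.
  by rewrite (leq_trans (size_scale_leq _ _)).
- near=> s'; rewrite (leq_trans (size_scale_leq _ _))//.
  by near: s'.
- move=> i; rewrite coefD !coefZ; under eq_fun do rewrite coefZ.
  exact: is_cderiveM.
Unshelve. all: by end_near. Qed.

Lemma is_pderive_sum N (I : Type) (r : seq I) (P : I -> R -> {poly R[i]}) s
    (dP : I -> {poly R[i]}) :
  (forall i, is_pderive N (P i) s (dP i)) ->
  is_pderive N (fun s' => \sum_(i <- r) P i s') s (\sum_(i <- r) dP i).
Proof.
move=> Pd; elim: r => [|i r ih].
  rewrite big_nil; under eq_fun do rewrite big_nil.
  by apply: is_pderive_cst; rewrite size_poly0.
by rewrite big_cons; under eq_fun do rewrite big_cons; exact: is_pderiveD.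
Qed.

Lemma is_pderive_near N P Q s dP : (\forall s' \near s, P s' = Q s') ->
  is_pderive N P s dP -> is_pderive N Q s dP.
Proof.
move=> PQ [dPN PN Pd]; split => //.
- near=> s'; have <- : P s' = Q s' by near: s'.
  by near: s'.
- move=> i; apply: is_cderive_near (Pd i).
  by near=> s'; have -> : P s' = Q s' by near: s'.
Unshelve. all: by end_near. Qed.

Lemma is_pderive_widen N M P s dP : (N <= M)%N ->
  is_pderive N P s dP -> is_pderive M P s dP.
Proof.
move=> NM [dPN PN Pd]; split => //; first exact: leq_trans dPN NM.
near=> s'; apply: leq_trans NM; near: s'; exact: PN.
Unshelve. all: by end_near. Qed.

Lemma is_cderive_functional N L (dL : {poly R[i]} -> R[i]) P s dP :
  (\forall s' \near s, scalar (L s')) -> scalar dL ->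
  (forall i, is_cderive (fun s' => L s' 'X^i) s (dL 'X^i)) ->
  is_pderive N P s dP ->
  is_cderive (fun s' => L s' (P s')) s (L s dP + dL (P s)).
Proof.
move=> Lnear dLs Ld [dPN PN Pd].
have Ls : scalar (L s) := nbhs_singleton Lnear.
have PsN : (size (P s) <= N)%N := nbhs_singleton PN.
rewrite (scalar_coefE Ls dPN) (scalar_coefE dLs PsN) -big_split /=.
apply: (@is_cderive_near _ (fun s' => \sum_(i < N) (P s')`_i * L s' 'X^i)).
  near=> s'; symmetry; apply: scalar_coefE; first by near: s'.
  by near: s'.
by apply: is_cderive_sum => i; exact: is_cderiveM.
Unshelve. all: by end_near. Qed.

Lemma is_cderive_horner N P s dP : is_pderive N P s dP ->
  is_cderive (fun s' => (P s').[s'%:C]) s (dP.[s%:C] + (P s)^`().[s%:C]).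
Proof.
apply: (is_cderive_functional (L := fun s' p => p.[s'%:C])
  (dL := fun p => p^`().[s%:C])).
- by near=> s'; exact: scalar_horner.
- by move=> c p q; rewrite derivD derivZ hornerD hornerZ.
- move=> i; have dX : is_derive s 1 (fun z : R => z ^+ i) (i%:R * s ^+ i.-1).
    have -> : (fun z : R => z ^+ i) = id ^+ i.
      by apply/funext => z; rewrite exprfctE.
    by apply: is_derive_eq; rewrite /GRing.scale /= mulr1.
  have := is_cderive_real dX; rewrite rmorphM rmorph_nat rmorphXn mulr_natl.
  rewrite derivXn hornerMn hornerXn.
  by apply: is_cderive_near; near=> s'; rewrite hornerXn rmorphXn.
Unshelve. all: by end_near. Qed.

End MovingPolynomials.

(** * Biorthogonal expansions *)

Section BiorthogonalExpansion.
Context {K : fieldType}.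
Variables (B : {poly K} -> {poly K} -> K) (P Q : nat -> {poly K}).
Hypothesis Bl : forall q, scalar (fun p => B p q).
Hypothesis Psize : forall n, size (P n) = n.+1.
Hypothesis PQ : forall m n, B (P m) (Q n) = (m == n)%:R.

Lemma biorth_coef_neq0 n : (P n)`_n != 0.
Proof.
have := lead_coef_eq0 (P n); rewrite lead_coefE Psize /= => ->.
by rewrite -size_poly_eq0 Psize.
Qed.

Lemma biorth_expand (p : {poly K}) n : (size p <= n)%N ->
  p = \sum_(l < n) B p (Q l) *: P l.
Proof.
(* The degree bound is placed under the existential so that the induction hypothesis gives
   coefficients before the bound on the reduced polynomial is proved. Pairing with the Q's
   identifies them afterwards. *)
have [c] : exists c : nat -> K,
    (size p <= n)%N -> p = \sum_(l < n) c l *: P l.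
  elim: n p => [|n ih] p.
    exists (fun=> 0) => /[!leqn0] /[!size_poly_eq0] /eqP ->.
    by rewrite big_ord0.
  have [c hc] := ih (p - (p`_n / (P n)`_n) *: P n).
  exists (fun l => if l == n then p`_n / (P n)`_n else c l) => pn.
  rewrite big_ord_recr /= eqxx.
  rewrite (eq_bigr (fun l : 'I_n => c l *: P l)); last first.
    by move=> i _; rewrite ltn_eqF.
  rewrite -hc; first by rewrite subrK.
  apply/leq_sizeP => j; rewrite leq_eqVlt => /predU1P[<-|nj].
    by rewrite coefB coefZ divfK ?subrr// biorth_coef_neq0.
  have pj : p`_j = 0 by rewrite nth_default// (leq_trans pn).
  have Pj : (P n)`_j = 0 by rewrite nth_default// Psize.
  by rewrite coefB coefZ pj Pj mulr0 subrr.
move=> hc pn; rewrite {1}(hc pn); apply: eq_bigr => i _; congr (_ *: _).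
rewrite {1}(hc pn) (functional_sum _ _ (Bl _)) (bigD1 i)//= (functionalZ _ _ (Bl _)).
rewrite PQ eqxx mulr1 big1 ?addr0// => j ji.
by rewrite (functionalZ _ _ (Bl _)) PQ val_eqE (negPf ji) mulr0.
Qed.

Lemma biorth_low (p : {poly K}) n : (size p <= n)%N -> B p (Q n) = 0.
Proof.
move=> pn; rewrite (biorth_expand pn) (functional_sum _ _ (Bl _)) big1// => i _.
by rewrite (functionalZ _ _ (Bl _)) PQ ltn_eqF ?mulr0.
Qed.

Lemma biorth_lead (p : {poly K}) n : (size p <= n.+1)%N -> B p (Q n) = p`_n / (P n)`_n.
Proof.
move=> pn; rewrite [in RHS](biorth_expand pn) coef_sum big_ord_recr /= coefZ.
rewrite big1 ?add0r ?mulfK ?biorth_coef_neq0// => i _.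
have Pn : (P i)`_n = 0 by rewrite nth_default// Psize.
by rewrite coefZ Pn mulr0.
Qed.

End BiorthogonalExpansion.

Section CauchyBiorthogonal.
Context {K : fieldType}.
Variables (B : {poly K} -> {poly K} -> K) (P Q : nat -> {poly K}).
Variables (pi eta : {poly K} -> K) (ab : K) (S : nat -> K).
Hypothesis Bl : forall q, scalar (fun p => B p q).
Hypothesis Br : forall p, scalar (fun q => B p q).
Hypothesis Psize : forall n, size (P n) = n.+1.
Hypothesis Qsize : forall n, size (Q n) = n.+1.
Hypothesis Plead : forall n, (P n)`_n = S n.
Hypothesis Qlead : forall n, (Q n)`_n = S n.
Hypothesis PQ : forall m n, B (P m) (Q n) = (m == n)%:R.
Hypothesis BX : forall p q, B ('X * p) q + B p ('X * q) = pi p * eta q.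

Let QP m n : (fun p q => B q p) (Q m) (P n) = (m == n)%:R.
Proof. by rewrite /= PQ eq_sym. Qed.

Let size_mulXP n : (size ('X * P n)%R <= n.+2)%N.
Proof. by rewrite (leq_trans (size_polyMleq _ _))// size_polyX Psize. Qed.

Let size_mulXQ n : (size ('X * Q n)%R <= n.+2)%N.
Proof. by rewrite (leq_trans (size_polyMleq _ _))// size_polyX Qsize. Qed.

(** For l <= n the coefficient of P_l is B(x P_n, Q_l) = pi_n eta_l - B(P_n, x Q_l). The last
    pairing vanishes for l < n - 1 by degree and is S_{n-1} / S_n at l = n - 1. Keeping the sum of
    the eta_l P_l is deliberate: dividing by pi_n expresses that sum through three neighbours. *)
Lemma four_term n : 'X * P n =
  (S n / S n.+1) *: P n.+1 + \sum_(l < n.+1) (pi (P n) * eta (Q l)) *: P l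
  - B (P n) ('X * Q n) *: P n - (prv S n / S n) *: prv P n.
Proof.
rewrite {1}(biorth_expand Bl Psize PQ (size_mulXP n)) big_ord_recr /=.
rewrite (biorth_lead Bl Psize PQ (size_mulXP n)) coefXM /= !Plead.
have -> : \sum_(l < n.+1) B ('X * P n) (Q l) *: P l =
    \sum_(l < n.+1) (pi (P n) * eta (Q l)) *: P l -
    \sum_(l < n.+1) B (P n) ('X * Q l) *: P l.
  by rewrite -sumrB; apply: eq_bigr => l _; rewrite -scalerBl -BX addrK.
have -> : \sum_(l < n.+1) B (P n) ('X * Q l) *: P l =
    B (P n) ('X * Q n) *: P n + (prv S n / S n) *: prv P n.
  rewrite big_ord_recr /= addrC; congr (_ + _).
  case: n => [|n]; first by rewrite big_ord0 scaler0.
  rewrite big_ord_recr /= big1 ?add0r => [|l _].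
    rewrite (biorth_lead Br Qsize QP (size_mulXQ n)) coefXM /=.
    by rewrite !Qlead.
  rewrite (biorth_low Br Qsize QP) ?scale0r//.
  by rewrite (leq_trans (size_mulXQ _))//= ltnS.
by rewrite addrC opprD !addrA.
Qed.

Variables (J T : nat -> nat -> K).
Hypothesis by_parts : forall m n,
  B ('X * (P m)^`()) (Q n) + B (P m) ('X * (Q n)^`()) =
  - (1 + ab) * B (P m) (Q n) + B ('X * P m) (Q n) + B (P m) ('X * Q n)
  - J m n - T m n.

(** The operator p -> x p' is triangular: x P_m' is m P_m plus terms of lower degree. *)
Let BXderivP m n : (m <= n)%N ->
  B ('X * (P m)^`()) (Q n) = m%:R * (m == n)%:R.
Proof.
move=> mn; have sz : (size ('X * (P m)^`())%R <= m.+1)%N.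
  by rewrite size_mulXderiv ?Psize.
move: mn; rewrite leq_eqVlt => /predU1P[<-|mn]; last first.
  by rewrite (biorth_low Bl Psize PQ (leq_trans sz mn)) ltn_eqF// mulr0.
rewrite (biorth_lead Bl Psize PQ sz) eqxx mulr1 coefXM.
case: m {sz} => [|m] /=; first by rewrite mul0r.
by rewrite coef_deriv -[X in X / _]mulr_natl mulfK// biorth_coef_neq0.
Qed.

Let BXderivQ m n : (n <= m)%N ->
  B (P m) ('X * (Q n)^`()) = n%:R * (m == n)%:R.
Proof.
move=> nm; have sz : (size ('X * (Q n)^`())%R <= n.+1)%N.
  by rewrite size_mulXderiv ?Qsize.
move: nm; rewrite leq_eqVlt => /predU1P[<-|nm]; last first.
  by rewrite (biorth_low Br Qsize QP (leq_trans sz nm)) gtn_eqF// mulr0.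
rewrite (biorth_lead Br Qsize QP sz) eqxx mulr1 coefXM.
case: n {sz} => [|n] /=; first by rewrite mul0r.
by rewrite coef_deriv -[X in X / _]mulr_natl mulfK// (biorth_coef_neq0 Qsize).
Qed.

(** The diagonal case of [by_parts], where both Euler terms contribute m. It will eliminate the
    product pi_m eta_m from the matrix entries. *)
Lemma pi_eta_diag m :
  pi (P m) * eta (Q m) = m%:R + m%:R + 1 + ab + J m m + T m m.
Proof.
have := by_parts m m; rewrite BXderivP// BXderivQ// PQ eqxx !mulr1 => E.
by rewrite -BX; rewrite E; ring.
Qed.

Variables (dP dQ : nat -> {poly K}).
Hypothesis two_neq0 : 2 != 0 :> K.
Hypothesis dPsize : forall n, (size (dP n) <= n.+1)%N.
Hypothesis dQsize : forall n, (size (dQ n) <= n.+1)%N.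
Hypothesis dlead : forall n, (dP n)`_n = (dQ n)`_n.
Hypothesis dPQ : forall m n, B (dP m) (Q n) + B (P m) (dQ n) = J m n.

(** Here [dP] stands for s dP/ds. For l < m, [dQ l] has too low a degree to pair with P_m, so
    B(dP_m, Q_l) is exactly J_{m,l} and cancels the same term in [by_parts]. On the diagonal the
    equal leading coefficients of [dP m] and [dQ m] make the two pairings equal, hence each is
    J_{m,m} / 2. *)
Lemma deform_P m : 'X * (P m)^`() + dP m =
  (m%:R + 2^-1 * J m m) *: P m +
  \sum_(l < m) (pi (P m) * eta (Q l) - T m l) *: P l.
Proof.
have sz : (size ('X * (P m)^`() + dP m)%R <= m.+1)%N.
  rewrite (leq_trans (size_polyD _ _))// geq_max dPsize andbT.
  by rewrite size_mulXderiv ?Psize.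
rewrite {1}(biorth_expand Bl Psize PQ sz) big_ord_recr /= addrC; congr (_ + _).
  congr (_ *: _); rewrite (functionalD _ _ (Bl _)) BXderivP// eqxx mulr1.
  congr (_ + _); rewrite -(dPQ m m).
  rewrite (biorth_lead Bl Psize PQ (dPsize m)) (biorth_lead Br Qsize QP (dQsize m)).
  rewrite dlead Plead Qlead.
  by set x := _ / _; field.
apply: eq_bigr => l _; congr (_ *: _); rewrite (functionalD _ _ (Bl _)).
have lm := ltn_ord l.
have := by_parts m l; rewrite (BXderivQ (ltnW lm)) PQ gtn_eqF// !mulr0 addr0 add0r.
rewrite BX => ->.
have := dPQ m l; rewrite (biorth_low Br Qsize QP (leq_trans (dQsize l) lm)) addr0.
by move=> ->; ring.
Qed.

End CauchyBiorthogonal.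

(** * The Cauchy pairing and the Cauchy transforms on polynomials *)

Section PolynomialIntegrals.
Context {R : realType} {d : measure_display} {T : measurableType d}.
Variables (mu : {measure set T -> \bar R}) (D : set T).
Hypothesis mD : measurable D.
Variables (G e : T -> R[i]).
Hypothesis Gfin : forall k, cintegrable mu D (fun u => G u * ('X^k).[e u]).

Lemma cintegrable_poly_scalar p q (c : R[i]) :
  cintegrable mu D (fun u => G u * p.[e u]) ->
  cintegrable mu D (fun u => G u * q.[e u]) ->
  cintegrable mu D (fun u => G u * (c *: p + q).[e u]).
Proof.
move=> pi qi; apply: (eq_cintegrable mD) (cintegrableD mD (cintegrableZ mD c pi) qi).
by move=> u _; rewrite hornerD hornerZ; ring.
Qed.

Lemma cintegrable_poly p : cintegrable mu D (fun u => G u * p.[e u]).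
Proof.
rewrite (poly_sumXn (leqnn (size p))).
elim/big_ind: _ => [|p1 p2 h1 h2|i _].
- apply: (eq_cintegrable mD) (cintegrable0 mu D) => u _.
  by rewrite horner0 mulr0.
- by rewrite -[p1]scale1r; exact: cintegrable_poly_scalar.
- apply: (eq_cintegrable mD) (cintegrableZ mD p`_i (Gfin i)) => u _.
  by rewrite hornerZ; ring.
Qed.

(** Stated for any kernel [G] and evaluation point [e], it serves the one-variable integrals as well
    as the pairing, with [e] either coordinate of the quadrant. *)
Lemma cintegral_poly_scalar : scalar (fun p => cintegral mu D (fun u => G u * p.[e u])).
Proof.
move=> c p q; rewrite -(cintegralZ mD _ (cintegrable_poly p)).
rewrite -(cintegralD mD (cintegrableZ mD c (cintegrable_poly p)) (cintegrable_poly q)).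
by apply: eq_cintegral => u _; rewrite hornerD hornerZ; ring.
Qed.

End PolynomialIntegrals.

Section WeightFunctionals.
Context {R : realType}.
Local Notation mu := (@lebesgue_measure R).
Let mh := @measurable_halfline R.
Let mq := @measurable_quadrant R.

Section OneWeight.
Variable w : R -> R[i].
Hypothesis wfin : forall k, cintegrable mu halfline (fun x => w x * (x ^+ k)%:C).

Lemma wint_scalar : scalar (wint w).
Proof.
apply: (cintegral_poly_scalar mh) => k.
by apply: (eq_cintegrable mh) (wfin k) => x _; rewrite hornerXn rmorphXn.
Qed.

Let kernel_fin (t : R) (k : nat) : 0 < t ->
  cintegrable mu halfline (fun x => w x * (x ^+ k / (x + t))%:C).
Proof. exact: (cintegrable_kernel wfin k 1). Qed.

Let cauchy_kernel (t : R) (k : nat) (x : R) :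
  w x / (- t%:C - x%:C) * ('X^k).[x%:C] = - (w x * (x ^+ k / (x + t))%:C).
Proof.
rewrite hornerXn !(rmorphM, rmorphXn, fmorphV, rmorphD) /=.
by rewrite -opprD invrN [t%:C + _]addrC; ring.
Qed.

Let cauchy_integrable (t : R) (k : nat) : 0 < t ->
  cintegrable mu halfline (fun x => w x / (- t%:C - x%:C) * ('X^k).[x%:C]).
Proof.
move=> t0; apply: (eq_cintegrable mh) (cintegrableZ mh (-1) (kernel_fin k t0)).
by move=> x _; rewrite cauchy_kernel mulN1r.
Qed.

Lemma cauchy_transform_scalar (t : R) : 0 < t ->
  scalar (fun p => cauchy_transform w p (- t%:C)).
Proof.
by move=> t0; apply: (cintegral_poly_scalar mh) => k; exact: cauchy_integrable.
Qed.

Lemma cauchy_transformXn (t : R) (k : nat) : 0 < t ->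
  cauchy_transform w 'X^k (- t%:C) =
  - cintegral mu halfline (fun x => w x * (x ^+ k / (x + t))%:C).
Proof.
move=> t0; have wi := kernel_fin k t0.
rewrite -[RHS]mulN1r -(cintegralZ mh _ wi).
by apply: eq_cintegral => x _; rewrite cauchy_kernel mulN1r.
Qed.

(** From x / (-t - x) = -t / (-t - x) - 1. The inhomogeneous term [wint w p] is what distinguishes
    the recurrence of the transforms from that of the polynomials. *)
Lemma cauchy_transform_mulX (t : R) p : 0 < t ->
  cauchy_transform w ('X * p) (- t%:C) =
  - t%:C * cauchy_transform w p (- t%:C) - wint w p.
Proof.
move=> t0; move: p; apply: (scalar_ext
  (L1 := fun p => cauchy_transform w ('X * p) (- t%:C))
  (L2 := fun p => - t%:C * cauchy_transform w p (- t%:C) - wint w p)).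
- exact: scalar_mulX (cauchy_transform_scalar t0).
- apply: scalar_add; last exact: scalar_opp wint_scalar.
  exact: scalar_mull (cauchy_transform_scalar t0).
move=> k; rewrite -exprS !cauchy_transformXn// wintXn.
have i0 := kernel_fin k t0.
rewrite mulNr mulrN opprK -(cintegralZ mh _ i0).
have i1 := cintegrableZ mh t%:C i0.
have i2 := cintegrableZ mh (-1) (wfin k).
rewrite -[X in _ = _ + X]mulN1r -(cintegralZ mh _ (wfin k)).
rewrite -(cintegralD mh i1 i2).
have i3 := kernel_fin k.+1 t0.
rewrite -[LHS]mulN1r -(cintegralZ mh _ i3).
apply: eq_cintegral => x x0.
have xt : x%:C + t%:C != 0 :> R[i].
  by rewrite -rmorphD -[0]/(0%:C) (inj_eq (@complexI R)) gt_eqF// addr_gt0.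
rewrite exprS !(rmorphM, fmorphV, rmorphD) /=; field.
exact: xt.
Qed.

End OneWeight.

Section CauchyDerivative.
Variables (c kappa : R[i]) (s t : R).
Local Notation w := (weight c kappa s).
Hypotheses (hc : -1 < complex.Re c) (s0 : 0 < s) (t0 : 0 < t).
Hypothesis wfin : forall k, cintegrable mu halfline (fun x => w x * (x ^+ k)%:C).

(* [t] times the derivative of [t' |-> cauchy_transform w p (- t')] at [t]. *)
Definition euler_cauchy (p : {poly R[i]}) : R[i] :=
  (c + t%:C) * cauchy_transform w p (- t%:C) + wint w p +
  cauchy_transform w ('X * p^`()) (- t%:C) +
  p.[s%:C] * (jump c kappa s / (s + t)%:C).

Lemma euler_cauchy_scalar : scalar euler_cauchy.
Proof.
have cs := cauchy_transform_scalar wfin t0.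
apply: scalar_add; last exact: scalar_mulr (scalar_horner _).
apply: scalar_add; last exact: scalar_mulXderiv cs.
apply: scalar_add; last exact: wint_scalar.
exact: scalar_mull cs.
Qed.

(** Differentiation under the integral gives the kernel x^k / (x + t)^2. Multiplied by t it becomes
    x^k / (x + t) - x^(k+1) / (x + t)^2, and [weight_by_parts] replaces the last term by kernels of
    first order and the boundary term at the jump s. *)
Lemma is_cderive_cauchyXn (k : nat) :
  is_cderive (fun t' => cauchy_transform w 'X^k (- t'%:C)) t
    ((t^-1)%:C * euler_cauchy 'X^k).
Proof.
have := is_cderiveN (is_cderive_stieltjes wfin k t0); rewrite opprK.
pose I m l := cintegral mu halfline (fun x => w x * (x ^+ m / (x + t) ^+ l)%:C).
have Ifin m l := cintegrable_kernel wfin m l t0.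
have I1 m : cintegral mu halfline (fun x => w x * (x ^+ m / (x + t))%:C) = I m 1%N.
  by apply: eq_cintegral => x _; rewrite expr1.
have tH : t%:C * I k 2 = I k 1%N - I k.+1 2.
  rewrite /I -(cintegralZ mh _ (Ifin k 2)).
  rewrite -[- cintegral _ _ _]mulN1r -(cintegralZ mh _ (Ifin k.+1 2)).
  rewrite -(cintegralD mh (Ifin k 1%N) (cintegrableZ mh (-1) (Ifin k.+1 2))).
  apply: eq_cintegral => x x0.
  have xt : x%:C + t%:C != 0 :> R[i].
    by rewrite -rmorphD -[0]/(0%:C) (inj_eq (@complexI R)) gt_eqF// addr_gt0.
  rewrite [x ^+ k.+1]exprS !(rmorphM, rmorphXn, fmorphV, rmorphD) /=; field.
  exact: xt.
have E := weight_by_parts (kappa := kappa) k hc t0 s0 wfin.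
have E2 : (c + 1 + k%:R) * I k 1%N - I k.+1 1%N - I k.+1 2 =
    jump c kappa s * (s ^+ k / (s + t))%:C.
  rewrite -E.
  rewrite /I -(cintegral_lincomb mh _ (Ifin k 1%N) (Ifin k.+1 1%N) (Ifin k.+1 2)).
  by apply: eq_cintegral => x _; rewrite expr1; ring.
have -> : (t^-1)%:C * euler_cauchy 'X^k = I k 2.
  have tn0 : t%:C != 0 :> R[i].
    by rewrite -[0]/(0%:C) (inj_eq (@complexI R)) gt_eqF.
  apply: (mulfI tn0); rewrite tH mulrA -rmorphM mulfV ?gt_eqF// mul1r.
  have mX := cauchy_transform_mulX wfin 'X^k t0.
  rewrite -exprS !cauchy_transformXn// !I1 in mX.
  rewrite /euler_cauchy mulX_derivXn.
  rewrite (functionalZ _ _ (cauchy_transform_scalar wfin t0)) !cauchy_transformXn// !I1.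
  rewrite hornerXn -rmorphXn.
  have -> : (s ^+ k)%:C * (jump c kappa s / (s + t)%:C) =
      jump c kappa s * (s ^+ k / (s + t))%:C.
    by rewrite [in RHS]rmorphM [in RHS]fmorphV; ring.
  rewrite -E2.
  have -> : wint w 'X^k = t%:C * I k 1%N + I k.+1 1%N.
    by rewrite -[I k.+1 1%N]opprK mX; ring.
  by ring.
apply: is_cderive_near; near=> t'.
have t'0 : 0 < t' by near: t'; exact: lt_nbhsr.
by rewrite cauchy_transformXn.
Unshelve. all: by end_near. Qed.

End CauchyDerivative.
End WeightFunctionals.

Section PairingPolynomials.
Context {R : realType}.
Local Notation mu := (@lebesgue_measure R).
Let mh := @measurable_halfline R.
Let mq := @measurable_quadrant R.

Section Generic.
Variables w1 w2 : R -> R[i].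
Hypothesis w12 : forall j k, moment_integrable w1 w2 j k.

Let integrable_left (q : {poly R[i]}) (j : nat) :
  cintegrable (mu \x mu)%E quadrant (fun u =>
    w1 u.1 * w2 u.2 / (u.1 + u.2)%:C * q.[u.2%:C] * ('X^j).[u.1%:C]).
Proof.
have := cintegrable_poly mq (e := fun u => u.2%:C) (w12 j) q.
by apply: (eq_cintegrable mq) => u _; ring.
Qed.

Lemma pairing_scalar_l (q : {poly R[i]}) : scalar (fun p => pairing w1 w2 p q).
Proof.
have := cintegral_poly_scalar mq (e := fun u => u.1%:C) (integrable_left q).
have pE (p : {poly R[i]}) : cintegral (mu \x mu)%E quadrant (fun u =>
    w1 u.1 * w2 u.2 / (u.1 + u.2)%:C * q.[u.2%:C] * p.[u.1%:C]) = pairing w1 w2 p q.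
  by apply: eq_cintegral => u _; rewrite /pairing_integrand; ring.
by move=> Ls c p1 p2; rewrite -!pE; exact: Ls.
Qed.

Lemma pairing_scalar_r (p : {poly R[i]}) : scalar (fun q => pairing w1 w2 p q).
Proof.
apply: (cintegral_poly_scalar mq (e := fun u => u.2%:C)) => k.
have := cintegrable_poly mq (e := fun u => u.1%:C) (integrable_left 'X^k) p.
by apply: (eq_cintegrable mq) => u _; ring.
Qed.

End Generic.

Lemma pairing_swap (w1 w2 : R -> R[i]) :
  (forall j k, moment_integrable w1 w2 j k) ->
  forall p q, pairing w1 w2 p q = pairing w2 w1 q p.
Proof.
move=> w12; have w21 := moment_integrable_swap w12.
apply: (bilinear_ext (G := fun p q => pairing w2 w1 q p)).
- exact: pairing_scalar_l.
- exact: pairing_scalar_r.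
- by move=> q; exact: pairing_scalar_r.
- by move=> p; exact: pairing_scalar_l.
- exact: pairing_swapXX.
Qed.

Section TwoWeights.
Variables (a b xi psi : R[i]) (s t : R).
Local Notation w1 := (weight a xi s).
Local Notation w2 := (weight b psi t).
Hypotheses (ha : -1 < complex.Re a) (hb : -1 < complex.Re b).
Hypotheses (s0 : 0 < s) (t0 : 0 < t).
Hypothesis w12 : forall j k, moment_integrable w1 w2 j k.

(** Before the jump the step factor is 1, so this holds even when 1 - kappa = 0; it provides the
    slices required by [finite_moments_right]. *)
Let weight_neq0 (c kappa : R[i]) (v x : R) : 0 < x < v -> weight c kappa v x != 0.
Proof.
move=> /andP[_ xv]; rewrite /weight ltNge (ltW xv) mulr0 subr0 mul1r.
rewrite mulf_neq0 ?cpow_neq0//.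
by rewrite -[0]/(0%:C) (inj_eq (@complexI R)) gt_eqF// expR_gt0.
Qed.

Lemma weight_right_moments k : cintegrable mu halfline (fun x => w2 x * (x ^+ k)%:C).
Proof. exact: (finite_moments_right w12 s0 (@weight_neq0 a xi s)). Qed.

Lemma weight_left_moments k : cintegrable mu halfline (fun x => w1 x * (x ^+ k)%:C).
Proof.
exact: (finite_moments_right (moment_integrable_swap w12) t0 (@weight_neq0 b psi t)).
Qed.

Lemma pairing_mulX p q : pairing w1 w2 ('X * p) q + pairing w1 w2 p ('X * q) =
  wint w1 p * wint w2 q.
Proof.
have pl := pairing_scalar_l w12; have pr := pairing_scalar_r w12.
have i1 := wint_scalar weight_left_moments.
have i2 := wint_scalar weight_right_moments.
move: p q; apply: (bilinear_ext
  (F := fun p q => pairing w1 w2 ('X * p) q + pairing w1 w2 p ('X * q))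
  (G := fun p q => wint w1 p * wint w2 q)).
- by move=> q; apply: scalar_add (pl _); exact: (scalar_mulX (pl q)).
- by move=> p; apply: scalar_add (pr _) _; exact: (scalar_mulX (pr p)).
- by move=> q; exact: scalar_mulr.
- by move=> p; exact: scalar_mull.
- move=> j k; rewrite -!exprS.
  exact: (pairing_addXX w12 weight_left_moments weight_right_moments).
Qed.

Lemma pairing_by_parts p q :
  pairing w1 w2 ('X * p^`()) q + pairing w1 w2 p ('X * q^`()) =
  - (1 + (a + b)) * pairing w1 w2 p q
  + pairing w1 w2 ('X * p) q + pairing w1 w2 p ('X * q)
  - jump a xi s * p.[s%:C] * cauchy_transform w2 q (- s%:C)
  - jump b psi t * cauchy_transform w1 p (- t%:C) * q.[t%:C].
Proof.
have pl := pairing_scalar_l w12; have pr := pairing_scalar_r w12.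
have c1 := cauchy_transform_scalar weight_left_moments t0.
have c2 := cauchy_transform_scalar weight_right_moments s0.
move: p q; apply: (bilinear_ext
  (F := fun p q => pairing w1 w2 ('X * p^`()) q + pairing w1 w2 p ('X * q^`()))
  (G := fun p q => - (1 + (a + b)) * pairing w1 w2 p q
  + pairing w1 w2 ('X * p) q + pairing w1 w2 p ('X * q)
  - jump a xi s * p.[s%:C] * cauchy_transform w2 q (- s%:C)
  - jump b psi t * cauchy_transform w1 p (- t%:C) * q.[t%:C])).
- by move=> q; apply: scalar_add (pl _); exact: (scalar_mulXderiv (pl q)).
- by move=> p; apply: scalar_add (pr _) _; exact: (scalar_mulXderiv (pr p)).
- move=> q; apply: scalar_add.
    apply: scalar_add.
      apply: scalar_add (pl _); apply: scalar_add; first exact: scalar_mull (pl q).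
      exact: (scalar_mulX (pl q)).
    by apply/scalar_opp/scalar_mulr/scalar_mull; exact: scalar_horner.
  exact/scalar_opp/scalar_mulr/scalar_mull.
- move=> p; apply: scalar_add.
    apply: scalar_add.
      apply: scalar_add; last exact: (scalar_mulX (pr p)).
      by apply: scalar_add (pr _); exact: scalar_mull (pr p).
    exact/scalar_opp/scalar_mull.
  by apply/scalar_opp/scalar_mull; exact: scalar_horner.
- move=> j k; rewrite !mulX_derivXn -!exprS.
  rewrite (functionalZ _ _ (pl _)) (functionalZ _ _ (pr _)) !hornerXn -!rmorphXn.
  rewrite (cauchy_transformXn weight_right_moments)//.
  rewrite (cauchy_transformXn weight_left_moments)//.
  have w21 := moment_integrable_swap w12.
  have e1 := pairing_by_parts_right hb t0 w12 weight_left_moments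
    weight_right_moments j k.
  have e2 := pairing_by_parts_right ha s0 w21 weight_right_moments
    weight_left_moments k j.
  rewrite !(pairing_swapXX w21) in e2.
  have e3 := pairing2_addXX w12 j k.
  (* Each integration by parts is solved for its second-order term; substituting both into [e3]
     leaves the claim. Its signs differ from these because a Cauchy transform at a negative point is
     minus the Stieltjes integral. *)
  have e1' : pairing2 w1 w2 j k = (b + 1 + k%:R) * pairing w1 w2 'X^j 'X^k -
      pairing w1 w2 'X^j 'X^(k.+1) -
      jump b psi t * (t ^+ k)%:C *
      cintegral mu halfline (fun x => w1 x * (x ^+ j / (x + t))%:C).
    by rewrite -e1; ring.
  have e2' : pairing2 w2 w1 k j = (a + 1 + j%:R) * pairing w1 w2 'X^j 'X^k -
      pairing w1 w2 'X^(j.+1) 'X^k -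
      jump a xi s * (s ^+ j)%:C *
      cintegral mu halfline (fun x => w2 x * (x ^+ k / (x + s))%:C).
    by rewrite -e2; ring.
  move: e3; rewrite e1' e2' => e3.
  apply/eqP; rewrite -subr_eq0; apply/eqP.
  move/eqP: e3; rewrite -subr_eq0 => /eqP <-.
  by ring.
Qed.

End TwoWeights.
End PairingPolynomials.

(** * The equations in the variable [s] *)

Section ThreeRows.
Context {K : fieldType}.

(* The rows of the matrix equations, in the notation of the context for the
   first one: [D m = s dP_m(s)/ds], [v m = P_m(s)], [f m = pi_m], [X n = X_{n,n}],
   [Y n = Y_{n,n}], [z = s], [kap = 0]; [C] collects the kernel [K^{0,0}]. *)
Definition three_rows (D v f g h J S X Y C : nat -> K) (ab z kap : K) (n : nat) :=
  [/\ D n.+1 =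
      (n%:R + 1 + kap - (S n * f n.+1) / (S n.+1 * f n) + 2^-1 * J n.+1) * v n.+1
      + f n.+1 / f n * (Y n + z) * v n
      + (prv S n * f n.+1) / (S n * f n) * prv v n - C n.+1 * g n.+1,
    D n = - (S n / S n.+1) * v n.+1
      + (Y n + z + kap - n%:R - ab - 1 - 2^-1 * J n) * v n
      + prv S n / S n * prv v n - C n.+1 * g n &
    prv D n = - ((S n * prv f n) / (S n.+1 * f n)) * v n.+1
      + (- (prv f n / f n * (X n - z)) + prv g n * h n) * v n
      + ((prv S n * prv f n) / (S n * f n) - n%:R - ab + kap
           - 2^-1 * prv J n) * prv v n - C n.+1 * prv g n].

(** [A] and [C] have increments e_m v_m and h_m v_m, and every row is rewritten through A_{n+1} and
    C_{n+1}, the former being known from the recurrence. In row n, passing from A_n to A_{n+1}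
    subtracts f_n e_n v_n; the diagonal relation then turns n + J_n / 2 into -(n + 1 + ab + J_n /
    2), whence the minus signs in the diagonal matrices, while g_n h_n is absorbed by passing from
    C_n to C_{n+1}. In the last row [C] is shifted twice, which leaves the extra middle entry
    g_{n-1} h_n. *)
Lemma three_rowsP (D v f e g h J S X Y A C : nat -> K) (ab z kap : K) :
  2 != 0 :> K -> (forall n, f n != 0) -> (forall n, S n != 0) ->
  (forall m, D m = (m%:R + kap + 2^-1 * J m) * v m + f m * A m - g m * C m) ->
  (forall m, A m.+1 = A m + e m * v m) ->
  (forall m, C m.+1 = C m + h m * v m) ->
  (forall n, f n * A n.+1 = z * v n - S n / S n.+1 * v n.+1 + Y n * v n
     + prv S n / S n * prv v n) ->
  (forall m, f m * e m = m%:R + m%:R + 1 + ab + J m + g m * h m) ->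
  (forall n, X n + Y n = f n * e n) ->
  forall n, three_rows D v f g h J S X Y C ab z kap n.
Proof.
move=> two0 f0 S0 DE AE CE RE fe XY n.
have An1 k : A k.+1 = (z * v k - S k / S k.+1 * v k.+1 + Y k * v k
     + prv S k / S k * prv v k) / f k.
  by rewrite -RE mulrAC mulfV ?mul1r.
have An k : f k * A k = z * v k - S k / S k.+1 * v k.+1 + Y k * v k
     + prv S k / S k * prv v k - f k * e k * v k.
  by rewrite -RE AE; ring.
split.
- rewrite DE An1 -natr1; field.
  by rewrite f0 !S0 two0.
- rewrite DE An fe CE; field.
  by rewrite !S0 two0.
- case: n => [|k] /=; first by rewrite !(mul0r, mulr0, oppr0, addr0, subr0).
  (* Going back one step from the recurrence at index k + 1 subtracts e_{k+1} v_{k+1}, and f e = X +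
     Y trades Y for -X: this is why X appears in the last row only. *)
  have fA : f k * A k.+1 = f k / f k.+1 * ((z - X k.+1) * v k.+1
      - S k.+1 / S k.+2 * v k.+2 + S k / S k.+1 * v k).
    have -> : X k.+1 = f k.+1 * e k.+1 - Y k.+1 by rewrite -XY addrK.
    have -> : A k.+1 = A k.+2 - e k.+1 * v k.+1 by rewrite (AE k.+1) addrK.
    rewrite An1 /=; field.
    by rewrite !S0 f0.
  have -> : D k = (- k.+1%:R - ab + kap - 2^-1 * J k) * v k + f k * A k.+1
      - g k * C k.+1.
    rewrite DE AE CE mulrDr mulrDr mulrA fe -natr1; field.
    exact: two0.
  rewrite fA (CE k.+1); field.
  by rewrite !S0 f0 two0.
Qed.

End ThreeRows.

Section Direction.
Context {R : realType}.
Local Notation mu := (@lebesgue_measure R).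
Variables (a b xi psi : R[i]) (s t : R).
Local Notation w1 := (weight a xi).
Local Notation w2 := (weight b psi t).
Hypotheses (ha : -1 < complex.Re a) (hb : -1 < complex.Re b).
Hypotheses (s0 : 0 < s) (t0 : 0 < t).
Hypothesis Mnear : \forall s' \near s, forall j k, moment_integrable (w1 s') w2 j k.
Variables (S : nat -> R -> R[i]) (P Q : nat -> R -> {poly R[i]}).
Hypothesis Sdiff : forall n, exists dS, is_cderive (S n) s dS.
Hypothesis Psize : \forall s' \near s, forall n, size (P n s') = n.+1.
Hypothesis Qsize : \forall s' \near s, forall n, size (Q n s') = n.+1.
Hypothesis Plead : \forall s' \near s, forall n, (P n s')`_n = S n s'.
Hypothesis Qlead : \forall s' \near s, forall n, (Q n s')`_n = S n s'.
Hypothesis PQ : \forall s' \near s, forall m n,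
  pairing (w1 s') w2 (P m s') (Q n s') = (m == n)%:R.

Let B := pairing (w1 s) w2.
Let q1 q := cauchy_transform w2 q (- s%:C).
Let p1 p := cauchy_transform (w1 s) p (- t%:C).
Let M := nbhs_singleton Mnear.
Let w2fin := weight_right_moments s0 M.
Let Bl q : scalar (fun p => B p q) := pairing_scalar_l M q.
Let Br p : scalar (B p) := pairing_scalar_r M p.
Let q1s : scalar q1 := cauchy_transform_scalar w2fin s0.

(** The derivative in s of the pairing of two fixed polynomials. The minus sign compensates that of
    the denominator -s - y in [q1], and the division by s that of the exponent a + 1 in [jump]. *)
Let dB (p q : {poly R[i]}) := (s^-1)%:C * - (jump a xi s * p.[s%:C] * q1 q).

Let dBl q : scalar (fun p => dB p q).
Proof. by apply/scalar_mull/scalar_opp/scalar_mulr/scalar_mull; exact: scalar_horner. Qed.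

Let dBr p : scalar (dB p).
Proof. exact/scalar_mull/scalar_opp/scalar_mull. Qed.

Lemma is_cderive_pairing_poly N1 N2 (F G : R -> {poly R[i]}) dF dG :
  is_pderive N1 F s dF -> is_pderive N2 G s dG ->
  is_cderive (fun s' => pairing (w1 s') w2 (F s') (G s')) s
    (B dF (G s) + (B (F s) dG + dB (F s) (G s))).
Proof.
move=> dFs dGs.
apply: (is_cderive_functional (L := fun s' p => pairing (w1 s') w2 p (G s'))
  (dL := fun p => B p dG + dB p (G s)) _ _ _ dFs).
- near=> s'; apply: pairing_scalar_l; near: s'; exact: Mnear.
- exact: scalar_add.
move=> i; apply: (is_cderive_functional (L := fun s' q => pairing (w1 s') w2 'X^i q)
  (dL := fun q => dB 'X^i q) _ _ _ dGs).
- near=> s'; apply: pairing_scalar_r; near: s'; exact: Mnear.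
- exact: dBr.
move=> k; have := is_cderive_pairing i k s0 w2fin Mnear; congr (is_cderive _ _ _).
rewrite /dB /q1 (cauchy_transformXn w2fin)// /jump cpowD1// hornerXn -rmorphXn.
have sn0 : s%:C != 0 :> R[i].
  by rewrite -[0]/(0%:C) (inj_eq (@complexI R)) gt_eqF.
by rewrite fmorphV; field.
Unshelve. all: by end_near. Qed.

Let is_pderive_XnB n (F : nat -> R -> {poly R[i]}) (G : nat -> R -> {poly R[i]})
    (c : nat -> R -> R[i]) :
  (forall l, (l < n)%N -> exists dF, is_pderive n.+1 (F l) s dF) ->
  (forall l, (l < n)%N -> exists dc, is_cderive (c l) s dc) ->
  exists dF, is_pderive n.+1 (fun s' =>
    S n s' *: ('X^n - \sum_(l < n) c l s' *: F l s')) s dF.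
Proof.
move=> Fd cd.
have [dF dFE] := fin_all_exists (fun l : 'I_n => Fd l (ltn_ord l)).
have [dc dcE] := fin_all_exists (fun l : 'I_n => cd l (ltn_ord l)).
have [dS dSE] := Sdiff n.
have X_d : is_pderive n.+1 (fun=> 'X^n) s 0.
  by apply: is_pderive_cst; rewrite size_polyXn.
have := is_pderive_sum (index_enum 'I_n) (fun l => is_pderiveZ (dcE l) (dFE l)).
move=> /(is_pderiveZ (is_cderive_cst (-1) s)) /(is_pderiveD X_d) /(is_pderiveZ dSE).
move=> h; eexists; apply: is_pderive_near h; near=> s'.
by rewrite scaleN1r.
Unshelve. all: by end_near. Qed.

(** Near s, P_n is S_n times x^n minus the sum over l < n of <x^n, Q_l> P_l, and symmetrically for
    Q_n. The right-hand side involves only S_n and lower indices, so both families are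
    differentiable by a joint induction. *)
Lemma biorthogonal_pderive n :
  (exists dP, is_pderive n.+1 (P n) s dP) /\ (exists dQ, is_pderive n.+1 (Q n) s dQ).
Proof.
elim/ltn_ind: n => n ih.
have Xn_d : is_pderive n.+1 (fun=> 'X^n) s 0.
  by apply: is_pderive_cst; rewrite size_polyXn.
split.
- have [||dF dFE] := @is_pderive_XnB n P Q
    (fun l s' => pairing (w1 s') w2 'X^n (Q l s')).
  + move=> l ln; have [[dP dPE] _] := ih _ ln; exists dP.
    by apply: is_pderive_widen dPE; rewrite ltnS ltnW.
  + move=> l ln; have [_ [dQ dQE]] := ih _ ln.
    by eexists; apply: is_cderive_pairing_poly Xn_d dQE.
  exists dF; apply: is_pderive_near dFE; near=> s'.
  have Ms' : forall j k, moment_integrable (w1 s') w2 j k by near: s'; exact: Mnear.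
  have Ps' : forall n, size (P n s') = n.+1 by near: s'; exact: Psize.
  have Pl : forall n, (P n s')`_n = S n s' by near: s'; exact: Plead.
  have PQs' m k : pairing (w1 s') w2 (P m s') (Q k s') = (m == k)%:R.
    by move: m k; near: s'; exact: PQ.
  have Sn0 : S n s' != 0.
    by rewrite -Pl; exact: (biorth_coef_neq0 (P := P ^~ s')).
  have szX : (size ('X^n : {poly R[i]}) <= n.+1)%N by rewrite size_polyXn.
  rewrite {1}(biorth_expand (pairing_scalar_l Ms') (P := P ^~ s') (Q := Q ^~ s')
    Ps' PQs' szX).
  rewrite big_ord_recr /= addrAC subrr add0r.
  rewrite (biorth_lead (pairing_scalar_l Ms') (P := P ^~ s') (Q := Q ^~ s')
    Ps' PQs' szX).
  by rewrite Pl coefXn eqxx scalerA mulrA mulr1 divff// scale1r.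
- have [||dF dFE] := @is_pderive_XnB n Q P
    (fun l s' => pairing (w1 s') w2 (P l s') 'X^n).
  + move=> l ln; have [_ [dQ dQE]] := ih _ ln; exists dQ.
    by apply: is_pderive_widen dQE; rewrite ltnS ltnW.
  + move=> l ln; have [[dP dPE] _] := ih _ ln.
    by eexists; apply: is_cderive_pairing_poly dPE Xn_d.
  exists dF; apply: is_pderive_near dFE; near=> s'.
  have Ms' : forall j k, moment_integrable (w1 s') w2 j k by near: s'; exact: Mnear.
  have Qs' : forall n, size (Q n s') = n.+1 by near: s'; exact: Qsize.
  have Ql : forall n, (Q n s')`_n = S n s' by near: s'; exact: Qlead.
  have PQs' m k : pairing (w1 s') w2 (P m s') (Q k s') = (m == k)%:R.
    by move: m k; near: s'; exact: PQ.
  have QPs' m k : (fun p q => pairing (w1 s') w2 q p) (Q m s') (P k s') = (m == k)%:R.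
    by rewrite /= PQs' eq_sym.
  have Sn0 : S n s' != 0.
    by rewrite -Ql; exact: (biorth_coef_neq0 (P := Q ^~ s')).
  have szX : (size ('X^n : {poly R[i]}) <= n.+1)%N by rewrite size_polyXn.
  rewrite {1}(biorth_expand (pairing_scalar_r Ms') (P := Q ^~ s') (Q := P ^~ s')
    Qs' QPs' szX).
  rewrite big_ord_recr /= addrAC subrr add0r.
  rewrite (biorth_lead (pairing_scalar_r Ms') (P := Q ^~ s') (Q := P ^~ s')
    Qs' QPs' szX).
  by rewrite Ql coefXn eqxx scalerA mulrA mulr1 divff// scale1r.
Unshelve. all: by end_near. Qed.

Let P' n := P n s.
Let Q' n := Q n s.
Let S' n := S n s.
Let P'size n : size (P' n) = n.+1 := nbhs_singleton Psize n.
Let Q'size n : size (Q' n) = n.+1 := nbhs_singleton Qsize n.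
Let P'lead n : (P' n)`_n = S' n := nbhs_singleton Plead n.
Let Q'lead n : (Q' n)`_n = S' n := nbhs_singleton Qlead n.
Let P'Q' m n : B (P' m) (Q' n) = (m == n)%:R := nbhs_singleton PQ m n.
Let Q'P' m n : (fun p q => B q p) (Q' m) (P' n) = (m == n)%:R.
Proof. by rewrite /= P'Q' eq_sym. Qed.

Let pi p := wint (w1 s) p.
Let eta q := wint w2 q.
Let J m n := jump a xi s * (P' m).[s%:C] * q1 (Q' n).
Let T m n := jump b psi t * p1 (P' m) * (Q' n).[t%:C].

Lemma deformation : exists dP dQ : nat -> {poly R[i]},
  [/\ forall m, is_pderive m.+1 (P m) s (dP m),
      forall m, is_pderive m.+1 (Q m) s (dQ m),
      forall m, 'X * (P' m)^`() + s%:C *: dP m =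
        (m%:R + 2^-1 * J m m) *: P' m +
        \sum_(l < m) (pi (P' m) * eta (Q' l) - T m l) *: P' l &
      forall m, 'X * (Q' m)^`() + s%:C *: dQ m =
        (m%:R + 2^-1 * J m m) *: Q' m +
        \sum_(l < m) (eta (Q' m) * pi (P' l) - T l m) *: Q' l].
Proof.
have [dP dPE] := choice (fun n => (biorthogonal_pderive n).1).
have [dQ dQE] := choice (fun n => (biorthogonal_pderive n).2).
exists dP, dQ.
have sn0 : s%:C != 0 :> R[i].
  by rewrite -[0]/(0%:C) (inj_eq (@complexI R)) gt_eqF.
have two0 : 2 != 0 :> R[i] by rewrite pnatr_eq0.
have szP n : (size (s%:C *: dP n)%R <= n.+1)%N.
  by have [h _ _] := dPE n; exact: leq_trans (size_scale_leq _ _) h.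
have szQ n : (size (s%:C *: dQ n)%R <= n.+1)%N.
  by have [h _ _] := dQE n; exact: leq_trans (size_scale_leq _ _) h.
have dlead n : (s%:C *: dP n)`_n = (s%:C *: dQ n)`_n.
  rewrite !coefZ; congr (_ * _).
  have [_ _ /(_ n) h1] := dPE n; have [_ _ /(_ n) h2] := dQE n.
  apply: is_cderive_unique h1 _; apply: is_cderive_near h2; near=> s'.
  have Pl : forall n, (P n s')`_n = S n s' by near: s'; exact: Plead.
  have Ql : forall n, (Q n s')`_n = S n s' by near: s'; exact: Qlead.
  by rewrite Pl Ql.
have dPQ m n : B (s%:C *: dP m) (Q' n) + B (P' m) (s%:C *: dQ n) = J m n.
  have h1 := is_cderive_pairing_poly (dPE m) (dQE n).
  have h2 : is_cderive (fun s' => pairing (w1 s') w2 (P m s') (Q n s')) s 0.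
    apply: is_cderive_near (is_cderive_cst (m == n)%:R s); near=> s'.
    by symmetry; move: m n {h1}; near: s'; exact: PQ.
  have := is_cderive_unique h1 h2.
  rewrite -/(P' m) -/(Q' n) (functionalZ _ _ (Bl _)) (functionalZ _ _ (Br _)).
  rewrite /dB -/(J m n) fmorphV => E.
  apply/eqP; rewrite -subr_eq0; apply/eqP.
  rewrite -(mulr0 s%:C) -E; field.
  exact: sn0.
have bpP m n : B ('X * (P' m)^`()) (Q' n) + B (P' m) ('X * (Q' n)^`()) =
    - (1 + (a + b)) * B (P' m) (Q' n) + B ('X * P' m) (Q' n) + B (P' m) ('X * Q' n)
    - J m n - T m n.
  exact: (pairing_by_parts ha hb s0 t0 M).
have BX p q : B ('X * p) q + B p ('X * q) = pi p * eta q.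
  exact: (pairing_mulX s0 t0 M).
split => // m.
- exact: (deform_P Bl Br P'size Q'size P'lead Q'lead P'Q' BX bpP two0 szP szQ dlead dPQ).
(* The equation for Q is [deform_P] for the transposed form, with pi and eta exchanged and J and T
   transposed. *)
- have QX p q : (fun p q => B q p) ('X * p) q + (fun p q => B q p) p ('X * q) =
      eta p * pi q.
    by rewrite /= addrC BX mulrC.
  have bpQ m' n : (fun p q => B q p) ('X * (Q' m')^`()) (P' n) +
      (fun p q => B q p) (Q' m') ('X * (P' n)^`()) =
      - (1 + (a + b)) * (fun p q => B q p) (Q' m') (P' n)
      + (fun p q => B q p) ('X * Q' m') (P' n)
      + (fun p q => B q p) (Q' m') ('X * P' n) - J n m' - T n m'.
    by rewrite /= addrC bpP; ring.
  have dQP m' n : (fun p q => B q p) (s%:C *: dQ m') (P' n) +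
      (fun p q => B q p) (Q' m') (s%:C *: dP n) = J n m'.
    by rewrite /= addrC dPQ.
  exact: (deform_P Br Bl Q'size P'size Q'lead P'lead Q'P' QX
    (J := fun m n => J n m) (T := fun m n => T n m) bpQ two0 szQ szP
    (fun n => esym (dlead n)) dQP).
Unshelve. all: by end_near. Qed.

Lemma euler_derive_P m : exists D, is_cderive (fun s' => (P m s').[s'%:C]) s D /\
  s%:C * D = (m%:R + 2^-1 * J m m) * (P' m).[s%:C] +
    \sum_(l < m) (pi (P' m) * eta (Q' l) - T m l) * (P' l).[s%:C].
Proof.
have [dP [dQ [dPE _ EP _]]] := deformation.
eexists; split; first exact: is_cderive_horner (dPE m).
have := congr1 (fun p => p.[s%:C]) (EP m).
rewrite !hornerD hornerZ hornerM hornerX hornerZ horner_sum => E.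
under [in RHS]eq_bigr do rewrite -hornerZ.
by rewrite -E -/(P' m); ring.
Qed.

(** Both Q_m and the point -s' move. The motion of the point contributes [euler_cauchy], whose term
    in x Q_m' is exactly what completes s dQ_m/ds to the left-hand side of the deformation equation,
    to which [q1] is then applied. *)
Lemma euler_derive_Q1 m : exists D,
  is_cderive (fun s' => cauchy_transform w2 (Q m s') (- s'%:C)) s D /\
  s%:C * D = (b + s%:C) * q1 (Q' m) + eta (Q' m) +
    (m%:R + 2^-1 * J m m) * q1 (Q' m) +
    \sum_(l < m) (eta (Q' m) * pi (P' l) - T l m) * q1 (Q' l) +
    (Q' m).[t%:C] * (jump b psi t / (t + s)%:C).
Proof.
have [dP [dQ [_ dQE _ EQ]]] := deformation.
eexists; split.
  apply: (is_cderive_functional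
    (L := fun s' q => cauchy_transform w2 q (- s'%:C))
    (dL := fun q => (s^-1)%:C * euler_cauchy b psi t s q) _ _ _ (dQE m)).
  - near=> s'; apply: cauchy_transform_scalar; first exact: w2fin.
    by near: s'; exact: lt_nbhsr.
  - exact: scalar_mull (euler_cauchy_scalar s0 w2fin).
  - by move=> k; exact: (is_cderive_cauchyXn hb t0 s0 w2fin).
have := congr1 q1 (EQ m).
rewrite !(functionalD _ _ q1s) !(functionalZ _ _ q1s) (functional_sum _ _ q1s) => E.
have -> : euler_cauchy b psi t s (Q m s) =
    (b + s%:C) * q1 (Q' m) + eta (Q' m) + q1 ('X * (Q' m)^`()) +
    (Q' m).[t%:C] * (jump b psi t / (t + s)%:C) by [].
rewrite -/(q1 (dQ m)).
have sn0 : s%:C != 0 :> R[i].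
  by rewrite -[0]/(0%:C) (inj_eq (@complexI R)) gt_eqF.
rewrite mulrDr mulrA [s%:C * (s^-1)%:C]mulrC -rmorphM mulVf ?gt_eqF// mul1r.
under [in RHS]eq_bigr do rewrite -(functionalZ _ _ q1s).
have -> : q1 ('X * (Q' m)^`()) = (m%:R + 2^-1 * J m m) * q1 (Q' m) +
    \sum_(i < m) q1 ((eta (Q' m) * pi (P' i) - T i m) *: Q' i) - s%:C * q1 (dQ m).
  by rewrite -E addrK.
by ring.
Unshelve. all: by end_near. Qed.

Let BX p q : B ('X * p) q + B p ('X * q) = pi p * eta q.
Proof. exact: (pairing_mulX s0 t0 M). Qed.

Let S'neq0 n : S' n != 0.
Proof. by rewrite -P'lead (biorth_coef_neq0 P'size). Qed.

Let two_neq0 : 2 != 0 :> R[i].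
Proof. by rewrite pnatr_eq0. Qed.

Let pi_eta m : pi (P' m) * eta (Q' m) =
  m%:R + m%:R + 1 + (a + b) + J m m + T m m.
Proof.
apply: (pi_eta_diag Bl Br P'size Q'size P'Q' BX) => k n.
exact: (pairing_by_parts ha hb s0 t0 M).
Qed.

Lemma rows_P : (forall n, pi (P' n) != 0) ->
  exists D : nat -> R[i],
  (forall m, is_cderive (fun s' => (P m s').[s'%:C]) s (D m)) /\
  forall n, three_rows (fun m => s%:C * D m) (fun m => (P' m).[s%:C])
    (fun m => pi (P' m)) (fun m => p1 (P' m))
    (fun m => jump b psi t * (Q' m).[t%:C]) (fun m => J m m) S'
    (fun m => B ('X * P' m) (Q' m)) (fun m => B (P' m) ('X * Q' m))
    (fun m => jump b psi t * \sum_(l < m) (P' l).[s%:C] * (Q' l).[t%:C])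
    (a + b) s%:C 0 n.
Proof.
move=> pi0; have [D DE] := choice euler_derive_P.
exists D; split; first by move=> m; have [] := DE m.
apply: (three_rowsP (e := fun m => eta (Q' m))
  (A := fun m => \sum_(l < m) eta (Q' l) * (P' l).[s%:C])) => //.
- move=> m; have [_ ->] := DE m.
  have -> : \sum_(l < m) (pi (P' m) * eta (Q' l) - T m l) * (P' l).[s%:C] =
      pi (P' m) * (\sum_(l < m) eta (Q' l) * (P' l).[s%:C]) -
      p1 (P' m) * (jump b psi t * \sum_(l < m) (P' l).[s%:C] * (Q' l).[t%:C]).
    rewrite !mulr_sumr -sumrB; apply: eq_bigr => l _.
    by rewrite /T; ring.
  by ring.
- by move=> m; rewrite big_ord_recr.
- by move=> m; rewrite big_ord_recr /=; ring.
- move=> n; have := four_term Bl Br P'size Q'size P'lead Q'lead P'Q' BX n.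
  move=> /(congr1 (fun p => p.[s%:C])).
  rewrite !hornerE horner_sum => E.
  have vE : (prv P' n).[s%:C] = prv (fun m => (P' m).[s%:C]) n.
    by case: (n) => //=; rewrite horner0.
  rewrite E vE mulr_sumr.
  have -> : \sum_(i < n.+1) (pi (P' n) * eta (Q' i) *: P' i).[s%:C] =
     \sum_(i < n.+1) pi (P' n) * (eta (Q' i) * (P' i).[s%:C]).
    by apply: eq_bigr => i _; rewrite hornerZ mulrA.
  by ring.
- by move=> m; rewrite pi_eta /T; ring.
Qed.

(** The additional terms of [euler_derive_Q1] fit the scheme of [three_rowsP]: b + s becomes the
    shift [kap], the term eta(Q_m) becomes the initial value 1 of [A], and the boundary term at t
    becomes the initial value 1 / (-t - s) of the kernel sum. The same 1 cancels the inhomogeneous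
    term of the transformed recurrence, where z = -s. *)
Lemma rows_Q1 : (forall n, eta (Q' n) != 0) ->
  exists D : nat -> R[i],
  (forall m, is_cderive (fun s' => cauchy_transform w2 (Q m s') (- s'%:C)) s (D m)) /\
  forall n, three_rows (fun m => s%:C * D m) (fun m => q1 (Q' m))
    (fun m => eta (Q' m)) (fun m => (Q' m).[t%:C])
    (fun m => jump b psi t * p1 (P' m)) (fun m => J m m) S'
    (fun m => B (P' m) ('X * Q' m)) (fun m => B ('X * P' m) (Q' m))
    (fun m => jump b psi t *
      (\sum_(l < m) p1 (P' l) * q1 (Q' l) + (- t%:C + - s%:C)^-1))
    (a + b) (- s%:C) (b + s%:C) n.
Proof.
move=> eta0; have [D DE] := choice euler_derive_Q1.
exists D; split; first by move=> m; have [] := DE m.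
have QX p q : (fun p q => B q p) ('X * p) q + (fun p q => B q p) p ('X * q) =
    eta p * pi q.
  by rewrite /= addrC BX mulrC.
apply: (three_rowsP (e := fun m => pi (P' m))
  (A := fun m => 1 + \sum_(l < m) pi (P' l) * q1 (Q' l))) => //.
- move=> m; have [_ ->] := DE m.
  have -> : \sum_(l < m) (eta (Q' m) * pi (P' l) - T l m) * q1 (Q' l) =
      eta (Q' m) * (\sum_(l < m) pi (P' l) * q1 (Q' l)) -
      (Q' m).[t%:C] * (jump b psi t * \sum_(l < m) p1 (P' l) * q1 (Q' l)).
    rewrite !mulr_sumr -sumrB; apply: eq_bigr => l _.
    by rewrite /T; ring.
  have -> : (- t%:C + - s%:C)^-1 = - (t + s)%:C^-1 :> R[i].
    by rewrite -opprD invrN rmorphD.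
  by ring.
- by move=> m; rewrite big_ord_recr /= addrA.
- by move=> m; rewrite big_ord_recr /=; ring.
- move=> n; have := four_term Br Bl Q'size P'size Q'lead P'lead Q'P' QX n.
  move=> /(congr1 q1); rewrite [LHS](cauchy_transform_mulX w2fin)//.
  rewrite !(functionalB _ _ q1s) !(functionalD _ _ q1s) !(functionalZ _ _ q1s).
  rewrite (functional_sum _ _ q1s) => E.
  have vE : q1 (prv Q' n) = prv (fun m => q1 (Q' m)) n.
    by case: (n) => //=; exact: functional0.
  rewrite vE in E.
  have {}E : - s%:C * q1 (Q' n) - eta (Q' n) = S' n / S' n.+1 * q1 (Q' n.+1) +
      \sum_(i < n.+1) q1 ((eta (Q' n) * pi (P' i)) *: Q' i) -
      B ('X * P' n) (Q' n) * q1 (Q' n) -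
      prv S' n / S' n * prv (fun m => q1 (Q' m)) n := E.
  have -> : eta (Q' n) * (1 + \sum_(l < n.+1) pi (P' l) * q1 (Q' l)) =
      eta (Q' n) + \sum_(i < n.+1) q1 ((eta (Q' n) * pi (P' i)) *: Q' i).
    rewrite mulrDr mulr1 mulr_sumr; congr (_ + _); apply: eq_bigr => i _.
    by rewrite (functionalZ _ _ q1s) mulrA.
  have -> : \sum_(i < n.+1) q1 ((eta (Q' n) * pi (P' i)) *: Q' i) =
      - s%:C * q1 (Q' n) - eta (Q' n) - (S' n / S' n.+1 * q1 (Q' n.+1)
      - B ('X * P' n) (Q' n) * q1 (Q' n)
      - prv S' n / S' n * prv (fun m => q1 (Q' m)) n).
    by rewrite E; ring.
  by ring.
- by move=> m; rewrite mulrC pi_eta /T; ring.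
Qed.

End Direction.

(** * The matrix equations *)

Section Assembly.
Context {R : realType}.

Lemma mat3_mulmx (K : fieldType) (m11 m12 m13 m21 m22 m23 m31 m32 m33 d x y z c e : K)
    (v g D : nat -> K) (n : nat) :
  e * D n.+1 = (m11 + d * x) * v n.+1 + m12 * v n + m13 * prv v n - c * g n.+1 ->
  e * D n = m21 * v n.+1 + (m22 + d * y) * v n + m23 * prv v n - c * g n ->
  e * prv D n = m31 * v n.+1 + m32 * v n + (m33 + d * z) * prv v n - c * prv g n ->
  e *: vec3 D n =
  (mat3 [:: [:: m11; m12; m13]; [:: m21; m22; m23]; [:: m31; m32; m33]]
    + d *: diag3 x y z) *m vec3 v n - c *: vec3 g n.
Proof.
move=> r1 r2 r3; apply/colP => i.
rewrite !mxE !big_ord_recl big_ord0 !mxE /=.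
case: i => [[|[|[|//]]] i3] /=; rewrite ?mulr1n ?mulr0n ?mulr0 ?addr0.
- by rewrite r1; ring.
- by rewrite r2; ring.
- by rewrite r3; ring.
Qed.

Lemma is_euler_derive_vec3 (F : nat -> R -> R[i]) (D : nat -> R[i]) s V n :
  (forall m, is_cderive (F m) s (D m)) -> s%:C *: vec3 D n = V ->
  is_euler_derive (fun s' => vec3 (fun m => F m s') n) s V.
Proof.
move=> FD DV; exists (vec3 D n) => // i.
have -> : (fun y => vec3 (fun m => F m y) n i 0) =
    (fun y => nth 0 [:: F n.+1 y; F n y; prv (fun m => F m y) n] i).
  by apply/funext => y; rewrite mxE.
rewrite mxE; case: i => [[|[|[|//]]] i3] /=; try exact: FD.
by case: (n) => [|k] /=; [exact: is_cderive_cst|exact: FD].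
Qed.

Lemma nbhs_slice1 (U : set (R * R)) s t : open U -> U (s, t) ->
  \forall s' \near s, U (s', t).
Proof.
move=> Uo Ust; have : nbhs (s, t) U by exact: open_nbhs_nbhs.
case=> -[A B] /= [As Bt] AB.
by apply: filterS As => s' As'; apply: AB; split => //=; exact: nbhs_singleton Bt.
Qed.

Lemma nbhs_slice2 (U : set (R * R)) s t : open U -> U (s, t) ->
  \forall t' \near t, U (s, t').
Proof.
move=> Uo Ust; have : nbhs (s, t) U by exact: open_nbhs_nbhs.
case=> -[A B] /= [As Bt] AB.
by apply: filterS Bt => t' Bt'; apply: AB; split => //=; exact: nbhs_singleton As.
Qed.

Lemma cdifferentiable_slice1 (f : R * R -> R[i]) s t : cdifferentiable f (s, t) ->
  exists df, is_cderive (fun s' => f (s', t)) s df.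
Proof.
have dpair : differentiable (fun s' : R => (s', t)) s by exact: differentiable_pair.
move=> [f1 f2].
have d1 : derivable (fun s' => complex.Re (f (s', t))) s 1.
  by apply/derivable1_diffP; exact: (differentiable_comp dpair f1).
have d2 : derivable (fun s' => complex.Im (f (s', t))) s 1.
  by apply/derivable1_diffP; exact: (differentiable_comp dpair f2).
exists ('D_1 (fun s' => complex.Re (f (s', t))) s +i*
        'D_1 (fun s' => complex.Im (f (s', t))) s).
by split; exact: derivableP.
Qed.

Lemma cdifferentiable_slice2 (f : R * R -> R[i]) s t : cdifferentiable f (s, t) ->
  exists df, is_cderive (fun t' => f (s, t')) t df.
Proof.
have dpair : differentiable (fun t' : R => (s, t')) t by exact: differentiable_pair.
move=> [f1 f2].
have d1 : derivable (fun t' => complex.Re (f (s, t'))) t 1.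
  by apply/derivable1_diffP; exact: (differentiable_comp dpair f1).
have d2 : derivable (fun t' => complex.Im (f (s, t'))) t 1.
  by apply/derivable1_diffP; exact: (differentiable_comp dpair f2).
exists ('D_1 (fun t' => complex.Re (f (s, t'))) t +i*
        'D_1 (fun t' => complex.Im (f (s, t'))) t).
by split; exact: derivableP.
Qed.

Lemma prvZ (c : R[i]) (f : nat -> R[i]) n :
  c * prv f n = prv (fun m => c * f m) n.
Proof. by case: n => //=; rewrite mulr0. Qed.

Lemma prvZM (c : R[i]) (f g : nat -> R[i]) n :
  prv (fun m => c * f m * g m) n = c * (prv f n * prv g n).
Proof. by case: n => /= [|n]; rewrite ?mul0r ?mulr0// mulrA. Qed.

End Assembly.

Unset Implicit Arguments.
Set Strict Implicit.
Set Printing Implicit Defensive.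

Theorem proposition4p13 (R : realType) (a b xi psi : R[i])
  (ha : -1 < complex.Re a) (hb : -1 < complex.Re b)
  (U : set (R * R)) (Uopen : open U)
  (Upos : forall s t, U (s, t) -> 0 < s /\ 0 < t)
  (* standing generic conditions *)
  (Mfin : forall s t, U (s, t) ->
     forall j k, moment_integrable (w1 a xi s) (w2 b psi t) j k)
  (Zneq0 : forall s t, U (s, t) -> forall n, Z a b xi psi n s t != 0)
  (* normalisation constants and biorthogonal polynomials *)
  (S : nat -> R -> R -> R[i]) (P Q : nat -> R -> R -> {poly R[i]})
  (Sdiff : forall s t, U (s, t) ->
     forall n, cdifferentiable (fun u => S n u.1 u.2) (s, t))
  (Ssqr : forall s t, U (s, t) ->
     forall n, S n s t ^+ 2 = Z a b xi psi n s t / Z a b xi psi n.+1 s t)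
  (Psize : forall s t, U (s, t) -> forall n, size (P n s t) = n.+1)
  (Qsize : forall s t, U (s, t) -> forall n, size (Q n s t) = n.+1)
  (Plead : forall s t, U (s, t) -> forall n, lead_coef (P n s t) = S n s t)
  (Qlead : forall s t, U (s, t) -> forall n, lead_coef (Q n s t) = S n s t)
  (PQorth : forall s t, U (s, t) -> forall m n,
     pairing (w1 a xi s) (w2 b psi t) (P m s t) (Q n s t) = (m == n)%:R)
  (pineq0 : forall s t, U (s, t) -> forall n, pi_ a xi P n s t != 0)
  (etaneq0 : forall s t, U (s, t) -> forall n, eta_ b psi Q n s t != 0) :
  forall (s t : R), U (s, t) -> forall n : nat,
  [/\ is_euler_derive (fun s' => vecP P n s' t s'%:C) s
        ((A0p a b xi psi S P Q n s t + Adiag a b xi psi P Q n s t)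
           *m vecP P n s t s%:C
         - (jump b psi t * K00 P Q n s t s%:C t%:C)
           *: vecP1 a xi P n s t (- t%:C)),
      is_euler_derive (fun t' => vecQ Q n s t' t'%:C) t
        ((D0p a b xi psi S P Q n s t + Ddiag a b xi psi P Q n s t)
           *m vecQ Q n s t t%:C
         - (jump a xi s * K00 P Q n s t s%:C t%:C)
           *: vecQ1 b psi Q n s t (- s%:C)),
      is_euler_derive (fun t' => vecP1 a xi P n s t' (- t'%:C)) t
        ((A0m a b xi psi S P Q n s t + Ddiag a b xi psi P Q n s t)
           *m vecP1 a xi P n s t (- t%:C)
         - (jump a xi s * K11 a b xi psi P Q n s t (- t%:C) (- s%:C))
           *: vecP P n s t s%:C) &
      is_euler_derive (fun s' => vecQ1 b psi Q n s' t (- s'%:C)) s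
        ((D0m a b xi psi S P Q n s t + Adiag a b xi psi P Q n s t)
           *m vecQ1 b psi Q n s t (- s%:C)
         - (jump b psi t * K11 a b xi psi P Q n s t (- t%:C) (- s%:C))
           *: vecQ Q n s t t%:C)].
Proof.
move=> s t Ust n.
have [s0 t0] := Upos _ _ Ust.
have U1 := nbhs_slice1 Uopen Ust; have U2 := nbhs_slice2 Uopen Ust.
have Pco s' t' : U (s', t') -> forall m, (P m s' t')`_m = S m s' t'.
  by move=> U' m; rewrite -(Plead _ _ U') lead_coefE (Psize _ _ U').
have Qco s' t' : U (s', t') -> forall m, (Q m s' t')`_m = S m s' t'.
  by move=> U' m; rewrite -(Qlead _ _ U') lead_coefE (Qsize _ _ U').
have Mswap s' t' (U' : U (s', t')) :
  forall j k, moment_integrable (w2 b psi t') (w1 a xi s') j k :=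
  moment_integrable_swap (Mfin _ _ U').
have QPorth s' t' : U (s', t') -> forall m k,
    pairing (w2 b psi t') (w1 a xi s') (Q m s' t') (P k s' t') = (m == k)%:R.
  move=> U' m k; rewrite (pairing_swap (Mswap _ _ U')).
  by rewrite (PQorth _ _ U') eq_sym.
have S1 m : exists dS, is_cderive (fun s' => S m s' t) s dS.
  exact: (cdifferentiable_slice1 (Sdiff _ _ Ust m)).
have S2 m : exists dS, is_cderive (fun t' => S m s t') t dS.
  exact: (cdifferentiable_slice2 (Sdiff _ _ Ust m)).
have sw p q : pairing (w2 b psi t) (w1 a xi s) p q =
    pairing (w1 a xi s) (w2 b psi t) q p by exact: pairing_swap (Mswap _ _ Ust) _ _.
(* Exchanging the weights exchanges the factors inside the kernel sums, which [ring] treats as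
   atoms; they are matched here beforehand. *)
have K0C : \sum_(l < n.+1) (P l s t).[s%:C] * (Q l s t).[t%:C] =
    \sum_(l < n.+1) (Q l s t).[t%:C] * (P l s t).[s%:C].
  by apply: eq_bigr => l _; rewrite mulrC.
have K1C : \sum_(l < n.+1) cauchy_transform (weight a xi s) (P l s t) (- t%:C) *
      cauchy_transform (weight b psi t) (Q l s t) (- s%:C) =
    \sum_(l < n.+1) cauchy_transform (weight b psi t) (Q l s t) (- s%:C) *
      cauchy_transform (weight a xi s) (P l s t) (- t%:C).
  by apply: eq_bigr => l _; rewrite mulrC.
split.
- have [D [DE /(_ n) [r1 r2 r3]]] := rows_P ha hb s0 t0
    (filterS (fun s' => Mfin s' t) U1) S1 (filterS (fun s' => Psize s' t) U1)
    (filterS (fun s' => Qsize s' t) U1) (filterS (fun s' => Pco s' t) U1)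
    (filterS (fun s' => Qco s' t) U1) (filterS (fun s' => PQorth s' t) U1)
    (pineq0 _ _ Ust).
  apply: (is_euler_derive_vec3 (F := fun m s' => (P m s' t).[s'%:C]) DE).
  apply: mat3_mulmx.
  + rewrite [LHS]r1
      /w1 /w2 /K00 /K11 /YY /XX /pi_ /eta_ /P0 /Q0 /P1 /Q1; ring.
  + rewrite [LHS]r2
      /w1 /w2 /K00 /K11 /YY /XX /pi_ /eta_ /P0 /Q0 /P1 /Q1; ring.
  + rewrite [LHS]prvZ [LHS]r3 prvZM
      /w1 /w2 /K00 /K11 /YY /XX /pi_ /eta_ /P0 /Q0 /P1 /Q1; ring.
- have [D [DE /(_ n) [r1 r2 r3]]] := rows_P hb ha t0 s0
    (filterS (Mswap s) U2) S2 (filterS (Qsize s) U2)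
    (filterS (Psize s) U2) (filterS (Qco s) U2)
    (filterS (Pco s) U2) (filterS (QPorth s) U2)
    (etaneq0 _ _ Ust).
  rewrite !sw in r1 r2 r3.
  apply: (is_euler_derive_vec3 (F := fun m t' => (Q m s t').[t'%:C]) DE).
  apply: mat3_mulmx.
  + rewrite [LHS]r1
      /w1 /w2 /K00 /K11 /YY /XX /pi_ /eta_ /P0 /Q0 /P1 /Q1 K0C; ring.
  + rewrite [LHS]r2
      /w1 /w2 /K00 /K11 /YY /XX /pi_ /eta_ /P0 /Q0 /P1 /Q1 K0C; ring.
  + rewrite [LHS]prvZ [LHS]r3 prvZM
      /w1 /w2 /K00 /K11 /YY /XX /pi_ /eta_ /P0 /Q0 /P1 /Q1 K0C; ring.
(* With the weights exchanged, the transformed family is P and the section's [eta] is the original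
   pi, hence the use of [pineq0]. *)
- have [D [DE /(_ n) [r1 r2 r3]]] := rows_Q1 hb ha t0 s0
    (filterS (Mswap s) U2) S2 (filterS (Qsize s) U2)
    (filterS (Psize s) U2) (filterS (Qco s) U2)
    (filterS (Pco s) U2) (filterS (QPorth s) U2)
    (pineq0 _ _ Ust).
  rewrite !sw in r1 r2 r3.
  apply: (is_euler_derive_vec3
    (F := fun m t' => cauchy_transform (w1 a xi s) (P m s t') (- t'%:C)) DE).
  apply: mat3_mulmx.
  + rewrite [LHS]r1
      /w1 /w2 /K00 /K11 /YY /XX /pi_ /eta_ /P0 /Q0 /P1 /Q1
      K1C [- t%:C + - s%:C]addrC; ring.
  + rewrite [LHS]r2
      /w1 /w2 /K00 /K11 /YY /XX /pi_ /eta_ /P0 /Q0 /P1 /Q1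
      K1C [- t%:C + - s%:C]addrC; ring.
  + rewrite [LHS]prvZ [LHS]r3 prvZM
      /w1 /w2 /K00 /K11 /YY /XX /pi_ /eta_ /P0 /Q0 /P1 /Q1
      K1C [- t%:C + - s%:C]addrC; ring.
- have [D [DE /(_ n) [r1 r2 r3]]] := rows_Q1 ha hb s0 t0
    (filterS (fun s' => Mfin s' t) U1) S1 (filterS (fun s' => Psize s' t) U1)
    (filterS (fun s' => Qsize s' t) U1) (filterS (fun s' => Pco s' t) U1)
    (filterS (fun s' => Qco s' t) U1) (filterS (fun s' => PQorth s' t) U1)
    (etaneq0 _ _ Ust).
  apply: (is_euler_derive_vec3
    (F := fun m s' => cauchy_transform (w2 b psi t) (Q m s' t) (- s'%:C)) DE).
  apply: mat3_mulmx.
  + rewrite [LHS]r1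
      /w1 /w2 /K00 /K11 /YY /XX /pi_ /eta_ /P0 /Q0 /P1 /Q1; ring.
  + rewrite [LHS]r2
      /w1 /w2 /K00 /K11 /YY /XX /pi_ /eta_ /P0 /Q0 /P1 /Q1; ring.
  + rewrite [LHS]prvZ [LHS]r3 prvZM
      /w1 /w2 /K00 /K11 /YY /XX /pi_ /eta_ /P0 /Q0 /P1 /Q1; ring.
Qed.
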